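(* Let $n\geq 2$ and let $\mathbb{K}$ be a field. The natural embedding $\varepsilon_{\mathrm{nat}}$ of $A_{n,\{1,n\}}(\mathbb{K})$ is relatively universal if and only if $\mathbb{K}$ is algebraic over its minimal subfield or perfect with positive characteristic.
   Context: $A_{n,\{1,n\}}(\mathbb{K})$ is the point-line geometry whose points are the flags $(p,H)$ with $p$ a point and $H$ a hyperplane of $\mathrm{PG}(n,\mathbb{K})$, $p\in H$; its lines are the sets $\ell_{p,S}=\{(p,X): X \text{ a hyperplane}, X\supset S\}$ ($S$ a subspace of codimension $2$, $p\in S$) and $\ell_{L,H}=\{(x,H): x\in L\}$ ($L$ a line contained in the hyperplane $H$). A projective embedding of a point-line geometry $\Gamma$ is an injective map $\varepsilon$ from the points of $\Gamma$ to the points of $\mathrm{PG}(V)$, $V$ a vector space, mapping every line of $\Gamma$ onto a line of $\mathrm{PG}(V)$, with image spanning $\mathrm{PG}(V)$. An embedding $\varepsilon':\Gamma\to\mathrm{PG}(V')$ covers $\varepsilon:\Gamma\to\mathrm{PG}(V)$ if there is a semilinear map $\phi:V'\to V$ with $\varepsilon=\phi\circ\varepsilon'$; it is a proper cover if $\phi$ is not injective. An embedding is relatively universal if it admits no proper cover. Let $A$ be the $\mathbb{K}$-vector space of $(n+1)\times(n+1)$ matrices over $\mathbb{K}$ with trace $0$. The natural embedding $\varepsilon_{\mathrm{nat}}:A_{n,\{1,n\}}(\mathbb{K})\to\mathrm{PG}(A)$ maps $(p,H)$, with $p$ represented by a non-zero row vector $v$ and $H$ by a non-zero linear functional $\alpha$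 (a column vector), to the point of $\mathrm{PG}(A)$ represented by the matrix $\alpha v$. The minimal subfield of $\mathbb{K}$ is its prime subfield. *)

(* Defs.v *)
From HB Require Import structures.
From mathcomp Require Import all_boot all_order all_algebra.
From mathcomp Require Import boolp classical_sets.

Set Implicit Arguments.
Unset Strict Implicit.
Unset Printing Implicit Defensive.

Import GRing.Theory.
Local Open Scope classical_set_scope.
Local Open Scope ring_scope.

(* V may be infinite-dimensional, so the points of PG(V) are 1-dimensional
   subspaces given as classical sets of vectors. *)
Definition vline (K : fieldType) (V : lmodType K) (v : V) : set V :=
  [set a *: v | a in setT].

Record pg_point (K : fieldType) (V : lmodType K) := PGPoint {
  pg_set :> set V;
  pg_pointP : exists2 v : V, v != 0 & pg_set = vline v }.

Lemma pg_point_inj (K : fieldType) (V : lmodType K) (P Q : pg_point V) :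
  pg_set P = pg_set Q -> P = Q.
Proof.
case: P Q => [P hP] [Q hQ] /= PQ; subst Q.
by rewrite (Prop_irrelevance hP hQ).
Qed.

Definition pg_of (K : fieldType) (V : lmodType K) (v : V) (v0 : v != 0) :
  pg_point V := PGPoint (ex_intro2 _ _ v v0 erefl).

Definition is_pg_line (K : fieldType) (V : lmodType K)
    (l : set (pg_point V)) : Prop :=
  exists P Q : pg_point V, P <> Q /\
    l = [set R : pg_point V | pg_set R `<=` [set u + w | u in P & w in Q]].

Definition is_subspace (K : fieldType) (V : lmodType K) (W : set V) : Prop :=
  [/\ W 0, forall u w, W u -> W w -> W (u + w)
    & forall (a : K) u, W u -> W (a *: u)].

Record point_line_geometry := PointLineGeometry {
  geom_point : Type;
  geom_line : set (set geom_point) }.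
Arguments geom_line : clear implicits.

Definition is_embedding (G : point_line_geometry) (K : fieldType)
    (V : lmodType K) (e : geom_point G -> pg_point V) : Prop :=
  [/\ injective e,
      forall l, geom_line G l -> is_pg_line (e @` l)
    & forall W : set V, is_subspace W ->
        (forall x, pg_set (e x) `<=` W) -> W = setT].

(* Since sigma is bijective, phi @` P is a subspace of dimension at most 1 for
   each point P; in particular the equation below forces phi to be non-zero on
   the points of the image of e'. *)
Definition covers_via (G : point_line_geometry)
    (K' : fieldType) (V' : lmodType K') (e' : geom_point G -> pg_point V')
    (K : fieldType) (V : lmodType K) (e : geom_point G -> pg_point V)
    (sigma : {rmorphism K' -> K}) (phi : {linear V' -> V | sigma \; *:%R}) :
  Prop :=
  bijective sigma /\ forall x, pg_set (e x) = phi @` pg_set (e' x).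

Definition proper_cover (G : point_line_geometry)
    (K' : fieldType) (V' : lmodType K') (e' : geom_point G -> pg_point V')
    (K : fieldType) (V : lmodType K) (e : geom_point G -> pg_point V) : Prop :=
  exists (sigma : {rmorphism K' -> K}) (phi : {linear V' -> V | sigma \; *:%R}),
    covers_via e' e phi /\ ~ injective phi.

Definition relatively_universal (G : point_line_geometry) (K : fieldType)
    (V : lmodType K) (e : geom_point G -> pg_point V) : Prop :=
  is_embedding e /\
  ~ exists (K' : fieldType) (V' : lmodType K') (e' : geom_point G -> pg_point V'),
      is_embedding e' /\ proper_cover e' e.

(* Subspaces of PG(n, K) are vector subspaces of K^(n+1), so projective
   dimension is \dim minus 1. *)
Record flag (n : nat) (K : fieldType) := Flag {
  flag_pt : {vspace 'rV[K]_n.+1};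
  flag_hyp : {vspace 'rV[K]_n.+1};
  flag_pt_dim : \dim flag_pt = 1%N;
  flag_hyp_dim : \dim flag_hyp = n;
  flag_incident : (flag_pt <= flag_hyp)%VS }.

Definition flag_line_pS (n : nat) (K : fieldType)
    (p S : {vspace 'rV[K]_n.+1}) : set (flag n K) :=
  [set F | flag_pt F = p /\ (S <= flag_hyp F)%VS].

Definition flag_line_LH (n : nat) (K : fieldType)
    (L H : {vspace 'rV[K]_n.+1}) : set (flag n K) :=
  [set F | flag_hyp F = H /\ (flag_pt F <= L)%VS].

Definition A1n (n : nat) (K : fieldType) : point_line_geometry :=
  @PointLineGeometry (flag n K)
    [set l |
       (exists p S : {vspace 'rV[K]_n.+1},
          [/\ \dim p = 1%N, (\dim S + 2 = n.+1)%N, (p <= S)%VS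
            & l = flag_line_pS p S])
    \/ (exists L H : {vspace 'rV[K]_n.+1},
          [/\ \dim L = 2%N, \dim H = n, (L <= H)%VS
            & l = flag_line_LH L H])].

Definition trace0 (m : nat) (K : fieldType) : {pred 'M[K]_m} :=
  fun M => \tr M == 0.

Lemma trace0_submod_closed (m : nat) (K : fieldType) :
  submod_closed (@trace0 m K).
Proof.
split=> [|a M N]; rewrite !unfold_in; first by rewrite mxtrace0.
by move=> /eqP hM /eqP hN; rewrite mxtraceD mxtraceZ hM hN mulr0 addr0.
Qed.

HB.instance Definition _ (m : nat) (K : fieldType) :=
  GRing.isSubmodClosed.Build K 'M[K]_m (@trace0 m K)
    (@trace0_submod_closed m K).

Record trace0_mx (m : nat) (K : fieldType) := Trace0Mx {
  trace0_val :> 'M[K]_m;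
  trace0_valP : trace0_val \in @trace0 m K }.

HB.instance Definition _ (m : nat) (K : fieldType) :=
  [isSub for @trace0_val m K].
HB.instance Definition _ (m : nat) (K : fieldType) :=
  [Choice of trace0_mx m K by <:].
HB.instance Definition _ (m : nat) (K : fieldType) :=
  [SubChoice_isSubLmodule of trace0_mx m K by <:].

Definition is_flag_rep (n : nat) (K : fieldType) (F : flag n K)
    (v : 'rV[K]_n.+1) (alpha : 'cV[K]_n.+1) : Prop :=
  [/\ v != 0, v \in flag_pt F, alpha != 0
    & forall x, (x \in flag_hyp F) = (x *m alpha == 0)].

Lemma hyperplane_functional (n : nat) (K : fieldType)
    (H : {vspace 'rV[K]_n.+1}) : \dim H = n ->
  exists2 alpha : 'cV[K]_n.+1, alpha != 0 &
    forall x, (x \in H) = (x *m alpha == 0).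
Proof.
move=> dH.
pose M : 'M[K]_(\dim H, n.+1) := \matrix_i (vbasis H)`_i.
have C0 : cokermx M != 0.
  rewrite -mxrank_eq0 mxrank_coker subn_eq0 -ltnNge ltnS.
  by rewrite (leq_trans (rank_leq_row M)) // dH.
have [j aj] : exists j, col j (cokermx M) != 0.
  apply/existsP; apply: contraR C0 => /existsPn h.
  apply/eqP/matrixP => i j; have := h j; rewrite negbK => /eqP/matrixP/(_ i 0).
  by rewrite !mxE.
exists (col j (cokermx M)) => //; set alpha := col j _ in aj *.
have Ma : M *m alpha = 0 by rewrite /alpha colE mulmxA mulmx_coker mul0mx.
pose f := linfun (mulmxr alpha : 'rV[K]_n.+1 -> 'M[K]_1).
have fE x : f x = x *m alpha by rewrite lfunE.
have sHf : (H <= lker f)%VS.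
  apply/subvP => x xH; rewrite memv_ker fE (coord_vbasis xH) mulmx_suml.
  rewrite big1 // => i _; rewrite -scalemxAl.
  have -> : (vbasis H)`_i = row i M by rewrite rowK.
  by rewrite -row_mul Ma row0 scaler0.
have df : (\dim (lker f) <= n)%N.
  rewrite leqNgt; apply: contra aj => lt.
  have kf : lker f = fullv.
    by apply/eqP; rewrite eqEdim subvf dimvf /dim /= mul1n.
  apply/eqP/row_matrixP => i; rewrite row0 rowE -fE; apply/eqP.
  by rewrite -memv_ker kf memvf.
have -> : H = lker f by apply/eqP; rewrite eqEdim sHf dH.
by move=> x; rewrite memv_ker fE.
Qed.

Lemma flag_rep_exists (n : nat) (K : fieldType) (F : flag n K) :
  exists va, is_flag_rep F va.1 va.2.
Proof.
have [a a0 ha] := hyperplane_functional (flag_hyp_dim F).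
exists (vpick (flag_pt F), a); split => //=; last exact: memv_pick.
by rewrite vpick0 -dimv_eq0 flag_pt_dim.
Qed.

Lemma flag_rep_trace0 (n : nat) (K : fieldType) (F : flag n K) v alpha :
  is_flag_rep F v alpha -> alpha *m v \in @trace0 n.+1 K.
Proof.
case=> _ vp _ hH; rewrite unfold_in mxtrace_mulC.
have /eqP -> : v *m alpha == 0 by rewrite -hH (subvP (flag_incident F)).
by rewrite mxtrace0.
Qed.

Lemma rank1_neq0 (m : nat) (K : fieldType) (v : 'rV[K]_m) (alpha : 'cV[K]_m) :
  v != 0 -> alpha != 0 -> alpha *m v != 0.
Proof.
move=> /rV0Pn[j vj] /cV0Pn[i ai]; apply/eqP => /matrixP/(_ i j)/eqP.
by rewrite !mxE big_ord1 mulf_eq0 (negPf vj) (negPf ai).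
Qed.

Definition nat_mx (n : nat) (K : fieldType) (F : flag n K) v alpha
    (r : is_flag_rep F v alpha) : trace0_mx n.+1 K :=
  Trace0Mx (flag_rep_trace0 r).

Lemma nat_mx_neq0 (n : nat) (K : fieldType) (F : flag n K) v alpha
    (r : is_flag_rep F v alpha) : nat_mx r != 0.
Proof.
rewrite -(inj_eq val_inj) /=.
by case: (r) => v0 _ a0 _; exact: rank1_neq0.
Qed.

Definition eps_nat (n : nat) (K : fieldType) (F : geom_point (A1n n K)) :
    pg_point (trace0_mx n.+1 K) :=
  pg_of (nat_mx_neq0 (projT2 (cid (flag_rep_exists F)))).

Lemma eps_natE (n : nat) (K : fieldType) (F : flag n K) v alpha
    (r : is_flag_rep F v alpha) :
  @eps_nat n K F = pg_of (nat_mx_neq0 r).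
Proof.
rewrite /eps_nat; move: (projT2 _).
case: (cid _) => [[w b] /= _] s; apply: pg_point_inj => /=.
have [v0 vp a0 hH] := r; have [/= w0 wp b0 hH'] := s.
have spanE (u : 'rV[K]_n.+1) : u != 0 -> u \in flag_pt F ->
    flag_pt F = <[u]>%VS.
  by move=> u0 up; apply/esym/eqP; rewrite eqEdim -memvE up flag_pt_dim dim_vline u0.
have [c wE] : exists c, w = c *: v.
  by move: wp; rewrite (spanE _ v0 vp) => /vlineP[c ->]; exists c.
have [u ua] : exists u : 'rV_n.+1, u *m alpha != 0.
  have /cV0Pn[i ai] := a0; exists (delta_mx 0 i).
  by rewrite -rowE; apply: contra ai => /eqP/matrixP/(_ 0 0); rewrite !mxE => ->.
have ua' : (u *m alpha) 0 0 != 0.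
  by apply: contra ua => /eqP h; apply/eqP/matrixP => i j; rewrite !ord1 h mxE.
pose d := (u *m b) 0 0 / (u *m alpha) 0 0.
have bE : b = d *: alpha.
  apply/row_matrixP => i; rewrite !rowE -scalemxAr; set x := delta_mx _ _.
  pose t := (x *m alpha) 0 0 / (u *m alpha) 0 0.
  have : (x - t *: u) *m b == 0.
    rewrite -hH' hH mulmxBl -scalemxAl; apply/eqP/matrixP => k l.
    rewrite !ord1 /t; move: (x *m alpha) (u *m alpha) ua' => X U U0.
    by rewrite !mxE divfK // subrr.
  rewrite mulmxBl -scalemxAl subr_eq0 => /eqP ->.
  apply/matrixP => k l; rewrite !ord1 [LHS]mxE [RHS]mxE /t /d.
  by rewrite mulrAC [RHS]mulrAC [(u *m b) 0 0 * _]mulrC.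
have dc0 : d * c != 0.
  rewrite mulf_neq0 //; [move: b0; rewrite bE | move: w0; rewrite wE];
  by apply: contra => /eqP ->; rewrite scale0r.
have nE : nat_mx s = (d * c) *: nat_mx r.
  apply: val_inj; rewrite /= wE bE -scalemxAl -scalemxAr scalerA.
  by [].
rewrite nE; apply/seteqP; split => x [k _ <-] /=.
  by exists (k * (d * c)) => //; rewrite scalerA.
by exists (k / (d * c)) => //; rewrite scalerA divfK.
Qed.

(* The intersection of all subfields of K. *)
Definition prime_subfield (K : fieldType) : {pred K} :=
  fun x => `[< forall S : {pred K}, divring_closed S -> x \in S >].

Definition algebraic_over_prime_subfield (K : fieldType) : Prop :=
  forall x : K, exists p : {poly K},
    [/\ p != 0, p \is a polyOver (@prime_subfield K) & root p x].

(* Vacuous in characteristic 0, where every field is perfect. *)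
Definition perfect_field (K : fieldType) : Prop :=
  forall p : nat, p \in [pchar K] -> forall x : K, exists y : K, y ^+ p = x.

Definition positive_char (K : fieldType) : Prop :=
  exists p : nat, p \in [pchar K].

(* Main.v *)
From HB Require Import structures.
From mathcomp Require Import all_boot all_order all_algebra.
From mathcomp Require Import boolp classical_sets.
From mathcomp Require Import ring.
Require Import Defs.

(** The condition on [K] says exactly that every derivation of [K] is zero: in
    characteristic p a derivation kills the p-th powers, and an element
    algebraic over the prime field is separable over it. The theorem is
    therefore a statement about derivations, and its two directions use them as
    follows.

    A non-zero derivation D gives a proper cover. A flag is a pair (v, al) of a
    row and a column with v al = 0, up to scalars, and the form
    sum_i v_i D(al_i) is additive in v and in al and homogeneous on such pairs:
    scaling al by c adds the term D(c) v al = 0. Hence (v, al) |-> (al v,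
    sum_i v_i D(al_i)) is an embedding in A x K that lies above the natural one
    ([derivation_cover]). It spans because x (E_jj - E_00) occurs together with
    D x, although A is already spanned linearly by images with second
    coordinate 0.

    Conversely let phi map an embedding e' onto the natural one. Each pair
    (v, al) has a unique lift in e' above al v; as e' maps lines onto lines, the
    lift is bilinear on the pairs with v al = 0 ([lift_orth]). Such a map need
    not come from a linear map on trace-zero matrices: after subtracting the
    only candidate, what is left is controlled by its values on the pairs
    (e_j - a e_0, e_0 + a e_j), and three coordinates, that is n >= 2, suffice
    to show that these values are a derivation in a
    ([torus_defect_derivation]). When derivations vanish the lift is thus
    linear in al v ([orth_bilinear_factor]); it inverts phi on a spanning set,
    so phi is injective ([cover_injective]).

    It remains to find a non-zero derivation when the condition fails
    ([derivation_exists]). A derivation defined on a subring of K is a subring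
    of the dual numbers K[eps] meeting eps K in 0. Starting from d/dx over the
    prime field with x transcendental, or over K^p with x not a p-th power,
    Zorn's lemma gives a maximal such subring, and one more element can always
    be adjoined ([adjoin_step]), so that the maximal one projects onto K. *)

Set Implicit Arguments.
Unset Strict Implicit.
Unset Printing Implicit Defensive.

Import GRing.Theory.
Local Open Scope ring_scope.

(** * Flags and their representatives *)

Section Flags.
Variables (n : nat) (K : fieldType).
Implicit Types (v x : 'rV[K]_n.+1) (al : 'cV[K]_n.+1) (F : flag n K).

Lemma flag_eq F F' :
  flag_pt F = flag_pt F' -> flag_hyp F = flag_hyp F' -> F = F'.
Proof.
case: F F' => p H dp dH i [p' H' dp' dH' i'] /= ep eH; subst p' H'.
by rewrite (Prop_irrelevance dp dp') (Prop_irrelevance dH dH')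
           (Prop_irrelevance i i').
Qed.

Definition hyp_of al : {vspace 'rV[K]_n.+1} :=
  lker (linfun (mulmxr al : 'rV[K]_n.+1 -> 'M[K]_1)).

Lemma mem_hyp_of al x : (x \in hyp_of al) = (x *m al == 0).
Proof. by rewrite memv_ker lfunE. Qed.

Lemma dim_hyp_of al : al != 0 -> \dim (hyp_of al) = n.
Proof.
move=> al0; set f := linfun (mulmxr al : 'rV[K]_n.+1 -> 'M[K]_1).
have := limg_ker_dim f fullv; rewrite capfv dimvf /dim /= mul1n => dE.
have : (\dim (f @: fullv) <= 1)%N.
  by rewrite (leq_trans (dimvS (subvf _))) // dimvf /dim /= muln1.
have : (0 < \dim (f @: fullv))%N.
  rewrite lt0n dimv_eq0; apply: contra al0 => /eqP f0.
  apply/eqP/row_matrixP => i; rewrite row0 rowE.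
  have := memv_img f (memvf (delta_mx 0 i)).
  by rewrite f0 memv0 lfunE => /eqP.
rewrite /hyp_of -/f; case: (\dim (f @: fullv)) dE => [|[|m]] // + _ _.
by rewrite addn1 => -[].
Qed.

Lemma mx11_eq0 (M : 'M[K]_1) : M 0 0 = 0 -> M = 0.
Proof. by move=> M0; apply/matrixP => i j; rewrite !ord1 M0 mxE. Qed.

Lemma rep_exists v al : v != 0 -> al != 0 -> v *m al = 0 ->
  exists F : flag n K, is_flag_rep F v al.
Proof.
move=> v0 al0 val0.
have vH : (<[v]> <= hyp_of al)%VS by rewrite -memvE mem_hyp_of val0.
have dv : \dim <[v]> = 1%N by rewrite dim_vline v0.
exists (Flag dv (dim_hyp_of al0) vH); split=> //; first exact: memv_line.
exact: mem_hyp_of.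
Qed.

Section Rep.
Variables (F : flag n K) (v : 'rV[K]_n.+1) (al : 'cV[K]_n.+1).
Hypothesis r : is_flag_rep F v al.

Lemma rep_pt : flag_pt F = <[v]>%VS.
Proof.
case: r => v0 vp _ _.
by apply/esym/eqP; rewrite eqEdim -memvE vp flag_pt_dim dim_vline v0.
Qed.

Lemma rep_hyp : flag_hyp F = hyp_of al.
Proof. by case: r => _ _ _ h; apply/vspaceP => x; rewrite h mem_hyp_of. Qed.

Lemma rep_mul0 : v *m al = 0.
Proof.
by case: r => _ vp _ h; apply/eqP; rewrite -h (subvP (flag_incident F)).
Qed.

Lemma rep_scale c d : c != 0 -> d != 0 -> is_flag_rep F (c *: v) (d *: al).
Proof.
move=> c0 d0; have [v0 vp al0 h] := r; split=> [||| x].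
- by rewrite scaler_eq0 negb_or c0.
- exact: memvZ.
- by rewrite scaler_eq0 negb_or d0.
- by rewrite h -scalemxAr scaler_eq0 (negPf d0).
Qed.

End Rep.

Lemma rep_flag_eq F F' v al c d : c != 0 -> d != 0 ->
  is_flag_rep F v al -> is_flag_rep F' (c *: v) (d *: al) -> F = F'.
Proof.
move=> c0 d0 r r'; have s := rep_scale r c0 d0.
by apply: flag_eq; rewrite ?(rep_pt s) ?(rep_pt r') ?(rep_hyp s) ?(rep_hyp r').
Qed.

(** A flag can be recovered from its rank-one matrix: a non-zero row of the
    product is a multiple of both row factors, and the column factors are then
    compared on one non-zero column. *)
Lemma rank1_factors (v v' : 'rV[K]_n.+1) (al al' : 'cV[K]_n.+1) :
  v != 0 -> al != 0 -> v' != 0 -> al' != 0 -> al *m v = al' *m v' ->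
  exists2 c : K, c != 0 & v' = c *: v /\ al' = c^-1 *: al.
Proof.
move=> v0 al0 v0' al0' e.
have E i j : al i 0 * v 0 j = al' i 0 * v' 0 j.
  by move/matrixP: e => /(_ i j); rewrite !mxE !big_ord1.
have [i ai] : exists i, al' i 0 != 0 by apply/cV0Pn.
have [j vj] : exists j, v' 0 j != 0 by apply/rV0Pn.
have eq0 : al i 0 * v 0 j != 0 by rewrite E mulf_neq0.
have [ai0 vj0] : al i 0 != 0 /\ v 0 j != 0.
  by move: eq0; rewrite mulf_eq0 negb_or => /andP[].
have c0 : al i 0 / al' i 0 != 0 by rewrite mulf_neq0 ?invr_eq0.
exists (al i 0 / al' i 0) => //.
have v'E : v' = (al i 0 / al' i 0) *: v.
  apply/rowP => k; rewrite !mxE; apply: (mulfI ai).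
  by rewrite -E mulrA mulrCA mulfV // mulr1.
split=> //; apply/colP => k; apply: (mulfI c0); apply: (mulIf vj0).
rewrite [in RHS]mxE mulVKf // E v'E mxE; ring.
Qed.

Lemma rep_uniq F v v' al al' : is_flag_rep F v al -> is_flag_rep F v' al' ->
  exists c d, [/\ c != 0, d != 0, v' = c *: v & al' = d *: al].
Proof.
move=> r r'; have [v0 _ al0 _] := r; have [v0' _ al0' _] := r'.
have : pg_set (pg_of (nat_mx_neq0 r)) (nat_mx r').
  by rewrite -(eps_natE r) (eps_natE r'); exists 1; rewrite ?scale1r.
case=> a _ /(congr1 val) /= e; rewrite scalemxAr in e.
have a0 : a != 0.
  apply: contra (rank1_neq0 v0' al0') => /eqP a0.
  by rewrite -e a0 scale0r mulmx0.
have av0 : a *: v != 0 by rewrite scaler_eq0 negb_or a0.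
have [c c0 [-> ->]] := rank1_factors av0 al0 v0' al0' e.
exists (c * a), c^-1; split; rewrite ?invr_eq0 ?mulf_neq0 //.
by rewrite scalerA.
Qed.

End Flags.

(** * Maps that are bilinear on orthogonal pairs *)

(** What is left of bilinearity when only flags are available: v and al
    represent a point and a hyperplane, incident precisely when v al = 0, and
    the two additivity clauses are read off the two kinds of lines. *)
Record orth_bilinear (K : fieldType) (m : nat) (V : lmodType K)
    (w : 'rV[K]_m -> 'cV[K]_m -> V) : Prop := OrthBilinear {
  obZl : forall a v al, v *m al = 0 -> w (a *: v) al = a *: w v al;
  obZr : forall a v al, v *m al = 0 -> w v (a *: al) = a *: w v al;
  obDl : forall v v' al, v *m al = 0 -> v' *m al = 0 ->
           w (v + v') al = w v al + w v' al;
  obDr : forall v al al', v *m al = 0 -> v *m al' = 0 ->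
           w v (al + al') = w v al + w v al' }.

Definition derivation (K : fieldType) (V : lmodType K) (D : K -> V) : Prop :=
  (forall a b, D (a + b) = D a + D b) /\
  (forall a b, D (a * b) = a *: D b + b *: D a).

Section OrthBilinear.
Variables (K : fieldType) (n : nat) (V : lmodType K).
Variable w : 'rV[K]_n.+1 -> 'cV[K]_n.+1 -> V.
Hypothesis hw : orth_bilinear w.

Lemma ob0l al : w 0 al = 0.
Proof. by rewrite -(scale0r 0) (obZl hw) ?mul0mx // scale0r. Qed.

Lemma ob0r v : w v 0 = 0.
Proof. by rewrite -(scale0r 0) (obZr hw) ?mulmx0 // scale0r. Qed.

Lemma ob_suml (I : finType) (P : pred I) (F : I -> 'rV[K]_n.+1) al :
  (forall i, P i -> F i *m al = 0) ->
  w (\sum_(i | P i) F i) al = \sum_(i | P i) w (F i) al.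
Proof.
move=> h; pose Q (x : 'rV[K]_n.+1) y := x *m al = 0 /\ w x al = y.
suff [] : Q (\sum_(i | P i) F i) (\sum_(i | P i) w (F i) al) by [].
apply: (big_ind2 Q) => [|x y x' y' [x0 <-] [x0' <-]|i Pi].
- by split; rewrite ?mul0mx ?ob0l.
- by split; rewrite ?mulmxDl ?x0 ?x0' ?addr0 ?(obDl hw).
- by split=> //; apply: h.
Qed.

Lemma ob_sumr (I : finType) (P : pred I) (F : I -> 'cV[K]_n.+1) v :
  (forall i, P i -> v *m F i = 0) ->
  w v (\sum_(i | P i) F i) = \sum_(i | P i) w v (F i).
Proof.
move=> h; pose Q (x : 'cV[K]_n.+1) y := v *m x = 0 /\ w v x = y.
suff [] : Q (\sum_(i | P i) F i) (\sum_(i | P i) w v (F i)) by [].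
apply: (big_ind2 Q) => [|x y x' y' [x0 <-] [x0' <-]|i Pi].
- by split; rewrite ?mulmx0 ?ob0r.
- by split; rewrite ?mulmxDr ?x0 ?x0' ?addr0 ?(obDr hw).
- by split=> //; apply: h.
Qed.

End OrthBilinear.

Definition er (K : fieldType) (n : nat) (i : 'I_n.+1) : 'rV[K]_n.+1 :=
  delta_mx 0 i.
Definition ec (K : fieldType) (n : nat) (i : 'I_n.+1) : 'cV[K]_n.+1 :=
  delta_mx i 0.
Arguments er {K n}.
Arguments ec {K n}.

Lemma er_ec (K : fieldType) (n : nat) (i j : 'I_n.+1) :
  er i *m ec j = (i == j)%:R *: 1 :> 'M[K]_1.
Proof.
rewrite /er /ec mul_delta_mx_cond -scaler_nat; congr (_ *: _).
by apply/matrixP => k l; rewrite !ord1 !mxE.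
Qed.

Lemma row_sum_er (K : fieldType) (n : nat) (v : 'rV[K]_n.+1) :
  v = \sum_j v 0 j *: er j.
Proof. exact: row_sum_delta. Qed.

Lemma col_sum_ec (K : fieldType) (n : nat) (al : 'cV[K]_n.+1) :
  al = \sum_i al i 0 *: ec i.
Proof.
by rewrite [LHS]matrix_sum_delta; apply: eq_bigr => i _; rewrite big_ord1.
Qed.

(** Orthogonality of explicit combinations of basis vectors, which is a
    polynomial identity in their coefficients. *)
Ltac orth neqs :=
  rewrite ?(mulmxDl, mulmxDr, mulmxN, mulNmx, =^~ scalemxAl, =^~ scalemxAr)
    ?er_ec ?eqxx ?neqs;
  apply: mx11_eq0; rewrite !mxE ?eqxx /=; ring.

Lemma neq3 (T : eqType) (i j k : T) : i != j -> i != k -> j != k ->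
  ((i == j) = false) * ((i == k) = false) * ((j == k) = false)
  * ((j == i) = false) * ((k == i) = false) * ((k == j) = false).
Proof.
move=> ij ik jk; rewrite (eq_sym j i) (eq_sym k i) (eq_sym k j).
by rewrite (negPf ij) (negPf ik) (negPf jk).
Qed.

Section NoDerivation.
Variables (K : fieldType) (n : nat) (V : lmodType K).
Variable f : 'rV[K]_n.+1 -> 'cV[K]_n.+1 -> V.
Hypothesis hf : orth_bilinear f.
Hypothesis f_off : forall i j : 'I_n.+1, i != j -> f (er j) (ec i) = 0.

(** If f were bilinear on all pairs this would be
    a (f e_j e_j - f e_i e_i), as f vanishes on the off-diagonal pairs; without
    the diagonal values to split it, only its dependence on a is in question. *)
Definition torus_defect (i j : 'I_n.+1) (a : K) : V :=
  f (er j - a *: er i) (ec i + a *: ec j).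
Local Notation g := torus_defect.

Section Distinct.
Variables i j k : 'I_n.+1.
Hypotheses (ij : i != j) (ik : i != k) (jk : j != k).
Let neqs := neq3 ij ik jk.

Lemma torus_defect_row a b :
  f (er j - a *: er i) (ec i + a *: ec j + b *: ec k) = g i j a.
Proof.
rewrite (obDr hf); [|orth neqs|orth neqs].
rewrite -[RHS]addr0; congr (_ + _).
rewrite (obZr hf) -?scaleNr; last by orth neqs.
rewrite (obDl hf) ?(obZl hf) ?f_off ?neqs //; try by orth neqs.
by rewrite !scaler0 addr0 scaler0.
Qed.

Lemma torus_defect_col a b :
  f (er j - a *: er i + b *: er k) (ec i + a *: ec j) = g i j a.
Proof.
rewrite (obDl hf); [|orth neqs|orth neqs].
rewrite -[RHS]addr0; congr (_ + _).
rewrite (obZl hf); last by orth neqs.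
rewrite (obDr hf) ?(obZr hf) ?f_off ?neqs //; try by orth neqs.
by rewrite !scaler0 addr0 scaler0.
Qed.

End Distinct.

Section Relations.
Variables i j k : 'I_n.+1.
Hypotheses (ij : i != j) (ik : i != k) (jk : j != k).
Let neqs := neq3 ij ik jk.

(** Two expansions of f on the column e_i + a e_j + b e_k and the row
    e_j + e_k - (a + b) e_i: by rows, as (e_j - a e_i) + (e_k - b e_i), and by
    columns, as (e_i + (a + b) e_j) + b (e_k - e_j). *)
Lemma torus_defectD a b :
  g i j a + g i k b = g i j (a + b) - b *: g j k (-1).
Proof.
pose v := er j - a *: er i + (er k - b *: er i).
pose al := ec i + a *: ec j + b *: ec k.
transitivity (f v al).
  rewrite /v /al (obDl hf); [|orth neqs|orth neqs].
  rewrite torus_defect_row // addrAC torus_defect_row ?neqs //.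
have -> : v = er j - (a + b) *: er i + 1 *: er k.
  by rewrite /v scale1r scalerDl opprD addrACA [RHS]addrAC addrA.
have -> : al = (ec i + (a + b) *: ec j) + b *: (ec k - ec j).
  by rewrite /al scalerDl scalerBr [b *: ec k - _]addrC !addrA addrK.
rewrite (obDr hf); [|orth neqs|orth neqs].
rewrite torus_defect_col // (obZr hf); last by orth neqs.
congr (_ + _); rewrite -[RHS]scalerN; congr (_ *: _).
rewrite addrAC -scaleNr (obDl hf); [|orth neqs|orth neqs].
rewrite (obZl hf); last by orth neqs.
rewrite (_ : f (er i) _ = 0) ?scaler0 ?addr0; last first.
  rewrite -scaleN1r (obDr hf) ?(obZr hf) ?f_off ?neqs //; try by orth neqs.
  by rewrite scaler0 addr0.
rewrite /g scaleN1r opprK -[RHS]scaleN1r -(obZr hf); last by orth neqs.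
by rewrite !scaleN1r opprB scale1r addrC.
Qed.

(** The column e_i + a e_j + a b e_k is orthogonal to the three rows
    e_k - a b e_i = (e_k - b e_j) + b (e_j - a e_i), each of which sees only
    two of its terms. *)
Lemma torus_defectM a b :
  g i k (a * b) = a *: g j k b + b *: g i j a.
Proof.
pose al := ec i + a *: ec j + (a * b) *: ec k.
transitivity (f (er k - (a * b) *: er i) al).
  by rewrite /al addrAC torus_defect_row ?neqs.
have -> : er k - (a * b) *: er i =
    (er k - b *: er j) + b *: (er j - a *: er i).
  by rewrite scalerBr scalerA addrA addrNK mulrC.
rewrite (obDl hf); [|rewrite /al; orth neqs|rewrite /al; orth neqs].
rewrite (obZl hf); last by rewrite /al; orth neqs.
congr (_ + _ *: _); last by rewrite /al torus_defect_row.
have -> : al = a *: (ec j + b *: ec k) + ec i.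
  by rewrite /al scalerDr scalerA [RHS]addrC addrA.
rewrite (obDr hf); [|orth neqs|orth neqs].
rewrite (obZr hf); last by orth neqs.
rewrite -[RHS]addr0; congr (_ + _); rewrite -scaleNr.
rewrite (obDl hf) ?(obZl hf) ?f_off ?neqs //; try by orth neqs.
by rewrite scaler0 addr0.
Qed.

End Relations.

Lemma torus_defect0 i j : i != j -> g i j 0 = 0.
Proof. by move=> ij; rewrite /g !scale0r subr0 addr0 f_off. Qed.

Hypothesis n_ge2 : (2 <= n)%N.
Hypothesis f_diag : forall j, j != 0 -> g 0 j 1 = 0.

Lemma third_index (i j : 'I_n.+1) : exists k, i != k /\ j != k.
Proof.
have : (0 < #|~: [set i; j]|)%N.
  rewrite cardsCs finset.setCK card_ord subn_gt0 cards2.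
  by case: (i == j); rewrite /= ltnS ?(leq_trans _ n_ge2).
case/card_gt0P => k; rewrite !inE negb_or => /andP[ki kj].
by exists k; rewrite ![_ == k]eq_sym.
Qed.

(** The normalization at a = 1 makes the defects at the pairs (0, j), (0, k) and
    (j, k) equal, k being a third index, and the two relations above become
    additivity and the Leibniz rule. *)
Lemma torus_defect_derivation j : j != 0 -> derivation (g 0 j).
Proof.
move=> j0; have [k [k0 jk]] := third_index 0 j.
have j0' : 0 != j by rewrite eq_sym.
have swap b : g 0 k b = g 0 j b - b *: g j k (-1).
  by have := torus_defectD j0' k0 jk 0 b;
    rewrite torus_defect0 // !add0r.
have jk1 : g j k (-1) = 0.
  have := swap 1; rewrite !f_diag ?(eq_sym k) // sub0r scale1r.
  by move/eqP; rewrite eq_sym oppr_eq0 => /eqP.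
have kj b : g 0 k b = g 0 j b by rewrite swap jk1 scaler0 subr0.
have jkj b : g j k b = g 0 j b.
  have := torus_defectM j0' k0 jk 1 b.
  by rewrite mul1r f_diag // scaler0 addr0 scale1r kj.
split=> a b.
  by have := torus_defectD j0' k0 jk a b; rewrite kj jk1 scaler0 subr0.
by have := torus_defectM j0' k0 jk a b; rewrite kj jkj.
Qed.

Hypothesis noD : forall D : K -> V, derivation D -> forall a, D a = 0.

(** When al has coefficient 1 at e_0, the rows orthogonal to it have basis
    e_j - al_j e_0, and on such a row f only sees the terms e_0 and al_j e_j
    of al: what remains is a defect, hence 0. *)
Lemma orth_bilinear_eq0_unit v al :
  v *m al = 0 -> al 0 0 = 1 -> f v al = 0.
Proof.
move=> val0 al1.
have v0E : v 0 0 = - \sum_(j | j != 0) v 0 j * al j 0.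
  move/matrixP: val0 => /(_ 0 0); rewrite !mxE (bigD1 0) //= al1 mulr1.
  by move/eqP; rewrite addr_eq0 => /eqP.
have er_al j : er j *m al = (al j 0)%:M.
  by rewrite -rowE; apply/matrixP => x y; rewrite !ord1 !mxE eqxx.
have orth_j j : (er j - al j 0 *: er 0) *m al = 0.
  rewrite mulmxBl -scalemxAl !er_al al1; apply: mx11_eq0.
  by rewrite !mxE eqxx /= !mulr1n mulr1 subrr.
have -> : v = \sum_(j | j != 0) v 0 j *: (er j - al j 0 *: er 0).
  rewrite {1}[v]row_sum_er (bigD1 0) //= v0E scaleNr addrC scaler_suml -sumrB.
  by apply: eq_bigr => j _; rewrite scalerBr scalerA.
rewrite (ob_suml hf) => [|j _]; last by rewrite -scalemxAl orth_j scaler0.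
apply: big1 => j j0; rewrite (obZl hf) //.
have j0' : 0 != j by rewrite eq_sym.
have neqs : ((0 == j) = false) * ((j == 0) = false).
  by rewrite (negPf j0) (negPf j0').
set v' := er j - _.
have v'k k : k != 0 -> k != j -> v' *m ec k = 0.
  move=> k0 kj; have neqs' := neq3 k0 kj j0'.
  by rewrite /v'; orth neqs'.
have alE : al = (ec 0 + al j 0 *: ec j)
    + \sum_(k | (k != 0) && (k != j)) al k 0 *: ec k.
  by rewrite {1}[al]col_sum_ec (bigD1 0) //= al1 scale1r (bigD1 j) //= addrA.
rewrite alE (obDr hf); last 2 first.
- by rewrite /v'; orth neqs.
- rewrite mulmx_sumr big1 // => k /andP[k0 kj].
  by rewrite -scalemxAr v'k ?scaler0.
rewrite (ob_sumr hf) => [|k /andP[k0 kj]]; last first.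
  by rewrite -scalemxAr v'k ?scaler0.
rewrite big1 ?addr0 => [|k /andP[k0 kj]]; last first.
  rewrite (obZr hf) ?v'k // /v' -scaleNr.
  have neqs' := neq3 k0 kj j0'.
  rewrite (obDl hf) ?(obZl hf) ?f_off ?neqs' //; try by orth neqs'.
  by rewrite scaler0 addr0 scaler0.
have := noD (torus_defect_derivation j0) (al j 0).
by rewrite /g => ->; rewrite scaler0.
Qed.

Lemma orth_bilinear_eq0 v al : v *m al = 0 -> f v al = 0.
Proof.
move=> val0; have [al00|al00] := eqVneq (al 0 0) 0; last first.
  have := @orth_bilinear_eq0_unit v ((al 0 0)^-1 *: al).
  rewrite -scalemxAr val0 scaler0 mxE mulVf // => /(_ erefl erefl).
  rewrite (obZr hf) // => /eqP.
  by rewrite scaler_eq0 invr_eq0 (negPf al00) => /eqP.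
pose v' := \sum_(j | j != 0) v 0 j *: er j.
have vE : v = v 0 0 *: er 0 + v' by rewrite [LHS]row_sum_er (bigD1 0).
have e0al : er 0 *m al = 0.
  by rewrite -rowE; apply: mx11_eq0; rewrite mxE.
have v'al : v' *m al = 0.
  by move: val0; rewrite {1}vE mulmxDl -scalemxAl e0al scaler0 add0r.
have v'e0 : v' *m ec 0 = 0.
  rewrite mulmx_suml big1 // => j j0.
  by rewrite -scalemxAl er_ec (negPf j0) scale0r scaler0.
rewrite vE (obDl hf) //; last by rewrite -scalemxAl e0al scaler0.
rewrite (obZl hf) // [al in f (er 0) al]col_sum_ec.
have e0k k : er 0 *m (al k 0 *: ec k) = 0.
  rewrite -scalemxAr er_ec; have [<-|_] := eqVneq 0 k; last first.
    by rewrite scale0r scaler0.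
  by rewrite al00 scale0r.
rewrite (ob_sumr hf) // big1 ?scaler0 ?add0r => [|k _]; last first.
  have [->|k0] := eqVneq k 0; first by rewrite al00 scale0r (ob0r hf).
  by rewrite (obZr hf) ?f_off ?scaler0 // er_ec eq_sym (negPf k0) scale0r.
(* The part v' of v off e_0 is orthogonal to e_0, so al may be changed to
   al + e_0, which has coefficient 1 there. *)
have : f v' (al + ec 0) = 0.
  apply: orth_bilinear_eq0_unit; first by rewrite mulmxDr v'al v'e0 addr0.
  by rewrite !mxE al00 add0r.
rewrite (obDr hf) // (_ : f v' (ec 0) = 0) ?addr0 //.
rewrite (ob_suml hf) => [|j j0]; last first.
  by rewrite -scalemxAl er_ec (negPf j0) scale0r scaler0.
apply: big1 => j j0; rewrite (obZl hf) ?er_ec ?(negPf j0) ?scale0r //.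
by rewrite f_off ?scaler0 // eq_sym.
Qed.

End NoDerivation.

(** * Linear maps on trace-zero matrices from orthogonal bilinear maps *)

Section TraceLift.
Variables (K : fieldType) (n : nat).
Implicit Types V U : lmodType K.

(** The value at E_jj - E_00 forced on a linear map L with
    L (al v) = w v al on orthogonal pairs, from the pair
    (e_j - e_0, e_0 + e_j). *)
Definition torus_lift V (w : 'rV[K]_n.+1 -> 'cV[K]_n.+1 -> V) (j : 'I_n.+1) : V :=
  w (er j - er 0) (ec 0 + ec j) - w (er j) (ec 0) + w (er 0) (ec j).

(** The only possible linear L on trace-zero matrices with L (al v) = w v al,
    written on the basis E_ij, i <> j, and E_jj - E_00, j <> 0. *)
Definition trace_lift V (w : 'rV[K]_n.+1 -> 'cV[K]_n.+1 -> V)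
    (M : 'M[K]_n.+1) : V :=
  \sum_i \sum_(j | j != i) M i j *: w (er j) (ec i)
  + \sum_(j | j != 0) M j j *: torus_lift w j.

Arguments trace_lift : simpl never.

Lemma trace_lift_is_linear V (w : 'rV[K]_n.+1 -> 'cV[K]_n.+1 -> V) :
  linear (trace_lift w).
Proof.
move=> a M N; rewrite /trace_lift scalerDr addrACA.
congr (_ + _).
  rewrite scaler_sumr -big_split; apply: eq_bigr => i _ /=.
  rewrite scaler_sumr -big_split; apply: eq_bigr => j _ /=.
  by rewrite !mxE scalerDl scalerA.
rewrite scaler_sumr -big_split; apply: eq_bigr => j _ /=.
by rewrite !mxE scalerDl scalerA.
Qed.
HB.instance Definition _ V (w : 'rV[K]_n.+1 -> 'cV[K]_n.+1 -> V) :=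
  GRing.isLinear.Build K 'M[K]_n.+1 V *:%R (trace_lift w)
    (trace_lift_is_linear w).

Lemma ec_er (i j : 'I_n.+1) : ec i *m er j = delta_mx i j :> 'M[K]_n.+1.
Proof. by rewrite mul_delta_mx. Qed.

Lemma trace_lift_off V (w : 'rV[K]_n.+1 -> 'cV[K]_n.+1 -> V) i j :
  i != j -> trace_lift w (ec i *m er j) = w (er j) (ec i).
Proof.
move=> ij; have ji : j != i by rewrite eq_sym.
rewrite ec_er /trace_lift (bigD1 i) //= (bigD1 j) //= mxE !eqxx scale1r.
rewrite big1 => [|k /andP[_ kj]]; last by rewrite mxE (negPf kj) andbF scale0r.
rewrite big1 => [|k ki]; last first.
  by rewrite big1 // => l _; rewrite mxE (negPf ki) scale0r.
rewrite big1 => [|k _]; first by rewrite !addr0.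
by rewrite mxE; have [->|] := eqVneq k i; rewrite ?(negPf ij) scale0r.
Qed.

Lemma trace_lift_diag V (w : 'rV[K]_n.+1 -> 'cV[K]_n.+1 -> V) i :
  trace_lift w (ec i *m er i) = if i == 0 then 0 else torus_lift w i.
Proof.
rewrite ec_er /trace_lift big1 => [|k _]; last first.
  rewrite big1 // => l lk; rewrite mxE.
  by have [ki|_] := eqVneq k i; rewrite ?scale0r // -ki (negPf lk) scale0r.
rewrite add0r; case: eqVneq => [->|i0].
  by rewrite big1 // => k k0; rewrite mxE (negPf k0) scale0r.
rewrite (bigD1 i) //= big1 => [|k /andP[_ ki]]; last first.
  by rewrite mxE (negPf ki) scale0r.
by rewrite mxE !eqxx scale1r addr0.
Qed.

Lemma trace_lift_torus V (w : 'rV[K]_n.+1 -> 'cV[K]_n.+1 -> V) j : j != 0 ->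
  trace_lift w ((ec 0 + ec j) *m (er j - er 0))
  = w (er j - er 0) (ec 0 + ec j).
Proof.
move=> j0; have j0' : 0 != j by rewrite eq_sym.
rewrite mulmxBr !mulmxDl (linearB (trace_lift w)) !(linearD (trace_lift w)) /=.
rewrite !trace_lift_diag !trace_lift_off // (negPf j0) add0r.
by rewrite /torus_lift addrA addrK addrC addrNK.
Qed.

Lemma trace_lift_comp V U (rho : {linear V -> U})
    (w : 'rV[K]_n.+1 -> 'cV[K]_n.+1 -> V) M :
  rho (trace_lift w M) = trace_lift (fun v al => rho (w v al)) M.
Proof.
rewrite /trace_lift linearD !linear_sum; congr (_ + _).
  by apply: eq_bigr => i _; rewrite linear_sum; apply: eq_bigr => j _;
    rewrite linearZ.
by apply: eq_bigr => j _; rewrite linearZ /torus_lift linearD linearB.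
Qed.

Lemma trace_lift_rank1 M : \tr M = 0 -> trace_lift (fun v al => al *m v) M = M.
Proof.
move=> tr0; have tE j : torus_lift (fun v al => al *m v) j =
    delta_mx j j - delta_mx 0 0 :> 'M[K]_n.+1.
  rewrite /torus_lift mulmxBr !mulmxDl !ec_er.
  rewrite [delta_mx 0 j + _]addrC opprD addrA.
  by rewrite (addrAC _ (- delta_mx 0 j)) addrNK (addrAC _ (- delta_mx 0 0)) addrK.
rewrite [RHS]matrix_sum_delta /trace_lift.
under [RHS]eq_bigr => i _ do rewrite (bigD1 i) //= addrC.
rewrite big_split /=; congr (_ + _).
  by apply: eq_bigr => i _; apply: eq_bigr => j _; rewrite ec_er.
have M0 : M 0 0 = - \sum_(j | j != 0) M j j.
  by move: tr0; rewrite /mxtrace (bigD1 0) //= => /eqP; rewrite addr_eq0 => /eqP.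
rewrite [RHS](bigD1 0) //= M0 scaleNr addrC scaler_suml -sumrB.
by apply: eq_bigr => j _; rewrite tE scalerBr.
Qed.

End TraceLift.

Lemma trace_lift_mem (K : fieldType) (n : nat) (V : lmodType K)
    (w : 'rV[K]_n.+1 -> 'cV[K]_n.+1 -> V) (W : set V) :
  is_subspace W -> (forall v al, v *m al = 0 -> W (w v al)) ->
  forall M, W (trace_lift w M).
Proof.
move=> [W0 WD WZ] Ww M.
have e0 i j : j != i -> W (w (er j) (ec i)).
  by move=> ji; apply: Ww; rewrite er_ec (negPf ji) scale0r.
have Wsum (I : finType) (P : pred I) (F : I -> V) :
    (forall i, P i -> W (F i)) -> W (\sum_(i | P i) F i).
  by move=> h; apply: (big_ind W).
rewrite /trace_lift; apply: (WD).
  by apply: (Wsum) => i _; apply: (Wsum) => j ji; apply: (WZ); apply: (e0).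
apply: (Wsum) => j j0.
apply: (WZ); apply: (WD); last by apply: (e0); rewrite eq_sym.
apply: (WD); last by rewrite -scaleN1r; apply: (WZ); apply: (e0).
apply: Ww; have j0' : 0 != j by rewrite eq_sym.
rewrite mulmxBl !mulmxDr !er_ec !eqxx (negPf j0) (negPf j0') !scale0r.
by rewrite add0r addr0 subrr.
Qed.

Lemma trace_lift_ext (K : fieldType) (n : nat) (V : lmodType K)
    (w w' : 'rV[K]_n.+1 -> 'cV[K]_n.+1 -> V) :
  (forall v al, v *m al = 0 -> w v al = w' v al) -> trace_lift w =1 trace_lift w'.
Proof.
move=> ww M.
have e0 i j : j != i -> w (er j) (ec i) = w' (er j) (ec i).
  by move=> ji; apply: ww; rewrite er_ec (negPf ji) scale0r.
rewrite /trace_lift; congr (_ + _).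
  by apply: eq_bigr => i _; apply: eq_bigr => j ji; rewrite e0.
apply: eq_bigr => j j0.
have j0' : 0 != j by rewrite eq_sym.
rewrite /torus_lift !e0 // ww // mulmxBl !mulmxDr !er_ec !eqxx.
by rewrite (negPf j0) (negPf j0') !scale0r add0r addr0 subrr.
Qed.

(** The difference between w and its only possible linear factorization
    vanishes on the pairs that defined the latter, so without derivations it
    vanishes. *)
Theorem orth_bilinear_factor (K : fieldType) (n : nat) (V : lmodType K)
    (w : 'rV[K]_n.+1 -> 'cV[K]_n.+1 -> V) :
  (2 <= n)%N -> (forall D : K -> V, derivation D -> forall a, D a = 0) ->
  orth_bilinear w ->
  forall v al, v *m al = 0 -> w v al = trace_lift w (al *m v).
Proof.
move=> n2 noD hw v al val0; apply/eqP; rewrite -subr_eq0; apply/eqP.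
pose f v al := w v al - trace_lift w (al *m v).
have hf : orth_bilinear f.
  split=> *; rewrite /f.
  - by rewrite (obZl hw) // -scalemxAr linearZ scalerBr.
  - by rewrite (obZr hw) // -scalemxAl linearZ scalerBr.
  - by rewrite (obDl hw) // mulmxDr (linearD (trace_lift w)) opprD addrACA.
  - by rewrite (obDr hw) // mulmxDl (linearD (trace_lift w)) opprD addrACA.
apply: (orth_bilinear_eq0 hf) val0 => // [i j ij|j j0].
  by rewrite /f trace_lift_off ?subrr.
by rewrite /torus_defect !scale1r /f trace_lift_torus ?subrr.
Qed.

(** * Fields on which all derivations vanish *)

Lemma prime_subfield_divring_closed (K : fieldType) :
  divring_closed (@prime_subfield K).
Proof.
split=> [|x y /asboolP hx /asboolP hy|x y /asboolP hx /asboolP hy];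
  apply/asboolP => S hS; have [S1 SB SD] := hS.
- exact: S1.
- by apply: SB; [apply: hx | apply: hy].
- by apply: SD; [apply: hx | apply: hy].
Qed.
HB.instance Definition _ (K : fieldType) :=
  GRing.isDivringClosed.Build K (@prime_subfield K)
    (@prime_subfield_divring_closed K).

Section DerivationVanishing.
Variables (K : fieldType) (V : lmodType K) (D : K -> V).
Hypothesis hD : derivation D.
Let DD := hD.1.
Let DM := hD.2.

Lemma der0 : D 0 = 0.
Proof. by apply: (addrI (D 0)); rewrite -DD !addr0. Qed.

Lemma der1 : D 1 = 0.
Proof. by apply: (addrI (D 1)); rewrite -{1 2}[D 1]scale1r -DM mulr1 addr0. Qed.

Lemma derB a b : D (a - b) = D a - D b.
Proof. by apply: (addIr (D b)); rewrite -DD !subrK. Qed.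

Lemma derX a k : D (a ^+ k.+1) = (a ^+ k *+ k.+1) *: D a.
Proof.
elim: k => [|k IHk]; first by rewrite expr0 expr1 mulr1n scale1r.
by rewrite exprS DM IHk scalerA mulrnAr -exprS -scalerDl -mulrSr.
Qed.

Lemma der_pchar p y : p \in [pchar K] -> D (y ^+ p) = 0.
Proof.
move=> cp; have := pcharf_prime cp; case: p cp => // p cp _.
by rewrite derX -mulr_natr (pcharf0 cp) mulr0 scale0r.
Qed.

Lemma der_prime_subfield x : x \in @prime_subfield K -> D x = 0.
Proof.
move=> /asboolP hx; suff /asboolP : x \in [pred x | `[< D x = 0 >]] by [].
apply: hx; split=> [|a b|a b].
- by apply/asboolP; exact: der1.
- by move=> /asboolP Da /asboolP Db; apply/asboolP; rewrite derB Da Db subr0.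
move=> /asboolP Da /asboolP Db; apply/asboolP.
rewrite DM Da scaler0 addr0; have [->|b0] := eqVneq b 0.
  by rewrite invr0 der0 scaler0.
have : D (b * b^-1) = 0 by rewrite mulfV // der1.
rewrite DM Db scaler0 addr0 => /eqP; rewrite scaler_eq0 (negPf b0) => /eqP ->.
by rewrite scaler0.
Qed.

Lemma der_horner (P : {poly K}) x : P \is a polyOver (@prime_subfield K) ->
  D P.[x] = P^`().[x] *: D x.
Proof.
elim/poly_ind: P => [|P c IHP] hP; first by rewrite deriv0 !horner0 der0 scale0r.
have hP' : P \is a polyOver (@prime_subfield K).
  by apply/polyOverP => i; move/polyOverP: hP => /(_ i.+1);
    rewrite coefD coefMX coefC addr0.
have hc : c \in @prime_subfield K.
  by move/polyOverP: hP => /(_ 0%N); rewrite coefD coefMX coefC add0r.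
rewrite hornerMXaddC DD DM IHP // (der_prime_subfield hc) addr0.
rewrite derivD derivM derivX derivC addr0 mulr1 hornerD hornerMX.
by rewrite scalerA -scalerDl mulrC addrC.
Qed.

End DerivationVanishing.

Lemma pchar_prime_subfield (K : fieldType) p (x : K) :
  p \in [pchar K] -> x \in @prime_subfield K -> x ^+ p = x.
Proof.
move=> cp /asboolP hx.
suff : x \in [pred y : K | y ^+ p == y] by rewrite inE => /eqP.
apply: hx; split=> [|a b|a b]; rewrite !inE ?expr1n //.
  by rewrite -!(pFrobenius_autE cp) rmorphB /= => /eqP -> /eqP ->.
by rewrite expr_div_n => /eqP -> /eqP ->.
Qed.

(** An element algebraic over the prime field is separable over it, so its
    derivative is forced to be 0 by its minimal polynomial P: if P' = 0 then,
    the coefficients being fixed by Frobenius, P is the p-th power of a smaller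
    polynomial at x. *)
Lemma derivation_algebraic (K : fieldType) (V : lmodType K) (D : K -> V) :
  algebraic_over_prime_subfield K -> derivation D -> forall x, D x = 0.
Proof.
move=> alg hD x; pose F := @prime_subfield K.
pose A k := `[< exists P : {poly K},
  [/\ P != 0, P \is a polyOver F, root P x & size P = k] >].
have exA : exists k, A k.
  by have [P [P0 oP rP]] := alg x; exists (size P); apply/asboolP; exists P.
case: (ex_minnP exA) => s /asboolP[P [P0 oP rP sP]] mins.
have minP (Q : {poly K}) : Q \is a polyOver F -> root Q x ->
    (size Q < size P)%N -> Q = 0.
  move=> oQ rQ lt; apply/eqP; apply: contraTT lt => Q0.
  by rewrite -leqNgt sP; apply: mins; apply/asboolP; exists Q.
have sP1 : (1 < size P)%N by apply: root_size_gt1 rP.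
have [P'0|P'0] := eqVneq P^`() 0; last first.
  have : D P.[x] = 0 by rewrite (rootP rP) (der0 hD).
  rewrite (der_horner hD) // => /eqP; rewrite scaler_eq0 => /orP[|/eqP] //.
  move=> r'; case/eqP: P'0; apply: minP => //; first exact: polyOver_deriv.
  by rewrite lt_size_deriv.
pose k := (size P).-1.
have k0 : (0 < k)%N by rewrite /k; case: (size P) sP1 => [|[]].
have natc i : i%:R * P`_i = 0.
  case: i => [|i]; first by rewrite mul0r.
  by have := coef_deriv P i; rewrite P'0 coef0 mulr_natl.
have kR : k%:R == 0 :> K.
  by have /eqP := natc k; rewrite mulf_eq0 lead_coef_eq0 (negPf P0) orbF.
have [p cp] := natf0_pchar k0 kR.
have p1 := prime_gt1 (pcharf_prime cp).
have pk : (p %| k)%N by rewrite (dvdn_pcharf cp).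
pose Q := \poly_(i < (k %/ p).+1) P`_(i * p).
have PQ : P = Q \Po 'X^p.
  apply/polyP => i; rewrite coef_comp_poly_Xn ?(ltnW p1) //.
  case: ifP => pi; last first.
    have /eqP := natc i; rewrite mulf_eq0 => /orP[|/eqP //].
    by rewrite -(dvdn_pcharf cp) pi.
  rewrite coef_poly divnK //; case: ifP => // /negbT; rewrite -leqNgt => lt.
  rewrite nth_default //; apply: (leq_trans (leqSpred _)); rewrite -/k.
  by rewrite -(divnK pk) -(divnK pi) ltn_mul2r (ltnW p1).
have oQ : Q \is a polyOver F.
  apply/polyOverP => i; rewrite coef_poly.
  by case: ifP; rewrite ?rpred0 // (polyOverP oP).
have QF : map_poly (pFrobenius_aut cp) Q = Q.
  apply/polyP => i; rewrite coef_map /= pFrobenius_autE.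
  exact: (pchar_prime_subfield cp (polyOverP oQ i)).
have rQ : root Q x.
  have : pFrobenius_aut cp Q.[x] = 0.
    rewrite -horner_map QF /= pFrobenius_autE.
    by move: (rootP rP); rewrite PQ horner_comp hornerXn.
  by move/eqP; rewrite pFrobenius_autE expf_eq0 => /andP[_]; rewrite /root.
case/eqP: P0; rewrite PQ (minP Q) ?comp_poly0 //.
rewrite (leq_ltn_trans (size_poly _ _)) // -(prednK (ltnW sP1)) ltnS -/k.
exact: ltn_Pdiv.
Qed.

Lemma derivation_perfect (K : fieldType) (V : lmodType K) (D : K -> V) :
  perfect_field K -> positive_char K -> derivation D -> forall x, D x = 0.
Proof.
by move=> perf [p cp] hD x; have [y <-] := perf p cp x; exact: (der_pchar hD).
Qed.

(** * Non-zero derivations from subrings of the dual numbers *)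

(** The ring K[eps] with eps^2 = 0, a pair (a, b) standing for a + b eps. A
    map D is a derivation on a subring of K when its graph is a subring of
    K[eps]. *)
Definition dual (K : fieldType) := (K * K)%type.
HB.instance Definition _ (K : fieldType) :=
  GRing.Zmodule.copy (dual K) (K * K)%type.

Section DualRing.
Variable K : fieldType.
Implicit Types u v w : dual K.

Definition dual_of (a b : K) : dual K := (a, b).
Definition dual_one : dual K := dual_of 1 0.
Definition dual_mul u v : dual K :=
  dual_of (u.1 * v.1) (u.1 * v.2 + v.1 * u.2).

Lemma dual_mulA : associative dual_mul.
Proof. by move=> [a a'] [b b'] [c c']; congr (_, _) => /=; ring. Qed.
Lemma dual_mulC : commutative dual_mul.
Proof. by move=> [a a'] [b b']; congr (_, _) => /=; ring. Qed.
Lemma dual_mul1 : left_id dual_one dual_mul.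
Proof. by move=> [a a']; congr (_, _) => /=; ring. Qed.
Lemma dual_mulDl : left_distributive dual_mul +%R.
Proof. by move=> [a a'] [b b'] [c c']; congr (_, _) => /=; ring. Qed.
Lemma dual_1neq0 : dual_one != 0.
Proof. by apply/eqP => -[] /eqP; rewrite oner_eq0. Qed.

HB.instance Definition _ := GRing.Zmodule_isComNzRing.Build (dual K)
  dual_mulA dual_mulC dual_mul1 dual_mulDl dual_1neq0.

Lemma dual_ofD a b c d : dual_of a b + dual_of c d = dual_of (a + c) (b + d).
Proof. by []. Qed.

Lemma dual_ofM a b c d :
  dual_of a b * dual_of c d = dual_of (a * c) (a * d + c * b).
Proof. by []. Qed.

(** The projection onto K, whose kernel is eps K. *)
Definition re (u : dual K) : K := u.1.
Arguments re : simpl never.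
Lemma re_is_zmod_morphism : zmod_morphism re.
Proof. by []. Qed.
Lemma re_is_monoid_morphism : monoid_morphism re.
Proof. by []. Qed.
HB.instance Definition _ := GRing.isZmodMorphism.Build (dual K) K re
  re_is_zmod_morphism.
HB.instance Definition _ := GRing.isMonoidMorphism.Build (dual K) K re
  re_is_monoid_morphism.

Lemma dual_reg u v : re u != 0 -> u * v = 0 -> v = 0.
Proof.
case: u v => [a a'] [b b'] /= a0 [] /eqP.
rewrite mulf_eq0 (negPf a0) /= => /eqP ->; rewrite mul0r addr0 => /eqP.
by rewrite mulf_eq0 (negPf a0) => /eqP ->.
Qed.

Lemma dual_real_expr y k : dual_of y 0 ^+ k = dual_of (y ^+ k) 0.
Proof.
elim: k => [|k IHk] //.
by rewrite exprS IHk dual_ofM !mulr0 addr0 -exprS.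
Qed.

Lemma dual_taylor (P : {poly (dual K)}) y z :
  P.[dual_of y z] = P.[dual_of y 0] + dual_of 0 z * P^`().[dual_of y 0].
Proof.
have -> : dual_of y z = dual_of y 0 + dual_of 0 z.
  by rewrite dual_ofD addr0 add0r.
set u := dual_of y 0; set h := dual_of 0 z.
have hh : h * h = 0 by rewrite dual_ofM !mul0r addr0.
elim/poly_ind: P => [|P c IHP]; first by rewrite deriv0 !horner0 mulr0 addr0.
rewrite !hornerMXaddC IHP derivD derivM derivX derivC addr0 mulr1.
rewrite hornerD hornerMX; move: (P.[u]) (P^`().[u]) => A B.
have -> : (A + h * B) * (u + h) + c =
  A * u + c + h * (B * u + A) + h * h * B by ring.
by rewrite hh mul0r addr0.
Qed.

End DualRing.

(** Euclidean descent over a ring where one can only multiply by the leading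
    coefficient of m: a property that passes from the pseudo-remainder to the
    dividend holds on all of I. *)
Lemma pseudo_division_ind (R : comNzRingType) (m : {poly R})
    (I J : {poly R} -> Prop) :
  m != 0 ->
  (forall P k, I P -> I (lead_coef m *: P - lead_coef P *: ('X^k * m))) ->
  (forall P, I P -> (size P < size m)%N -> J P) ->
  (forall P k, I P -> J (lead_coef m *: P - lead_coef P *: ('X^k * m)) -> J P) ->
  forall P, I P -> J P.
Proof.
move=> m0 Irem Jsmall Jrem P; have [s] := ubnP (size P).
elim: s P => // s IHs P; rewrite ltnS => sPs IP.
have [|mP] := ltnP (size P) (size m); first exact: Jsmall.
have sm : (0 < size m)%N by rewrite size_poly_gt0.
pose k := (size P - size m)%N; pose d := (size m).-1.
have sPE : size P = (k + d).+1 by rewrite -addnS /d prednK // subnK.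
apply: (Jrem P k IP); apply: IHs; last exact: Irem.
rewrite (leq_trans _ sPs) // sPE ltnS; apply/leq_sizeP => j.
rewrite coefB !coefZ coefXnM leq_eqVlt => /predU1P[<-|lt].
  by rewrite ltnNge leq_addr addKn {2}/lead_coef sPE /= mulrC subrr.
rewrite ltnNge (leq_trans (leq_addr d k) (ltnW lt)) /=.
rewrite !nth_default ?sPE ?mulr0 ?subrr //.
by rewrite -(prednK sm) ltn_subRL.
Qed.

(** The graph of a derivation with values in K on some subring of K: the last
    clause makes the second component a function of the first. *)
Definition partial_derivation (K : fieldType) (G : set (dual K)) : Prop :=
  [/\ G 1, forall u v, G u -> G v -> G (u - v),
      forall u v, G u -> G v -> G (u * v)
    & forall u, G u -> re u = 0 -> u = 0].

(** The boolean form of G, to speak of polynomials with coefficients in G. *)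
Definition membp (T : Type) (G : set T) : {pred T} := fun u => `[< G u >].

Section Adjoin.
Variables (K : fieldType) (G : set (dual K)).
Hypothesis hG : partial_derivation G.

Let S := membp G.
Lemma membp_subring : subring_closed S.
Proof.
have [G1 GB GM _] := hG; split=> [|u v|u v]; first by apply/asboolP.
  by move=> /asboolP Gu /asboolP Gv; apply/asboolP; apply: GB.
by move=> /asboolP Gu /asboolP Gv; apply/asboolP; apply: GM.
Qed.
HB.instance Definition _ :=
  GRing.isSubringClosed.Build (dual K) S membp_subring.

Lemma membp_re u : u \in S -> re u = 0 -> u = 0.
Proof. by have [_ _ _ Gre] := hG; move=> /asboolP /Gre. Qed.

Lemma over_coef (P : {poly (dual K)}) i : P \is a polyOver S -> G P`_i.
Proof. by move=> oP; apply/asboolP; exact: (polyOverP oP i). Qed.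

Lemma over_horner_ind (J : {poly (dual K)} -> Prop) :
  J 0 -> (forall P c, J P -> G c -> J (P * 'X + c%:P)) ->
  forall P, P \is a polyOver S -> J P.
Proof.
move=> J0 JS; elim/poly_ind => [//|P c IHP] oP; apply: JS.
  apply: IHP; apply/polyOverP => i; move/polyOverP: oP => /(_ i.+1).
  by rewrite coefD coefMX coefC addr0.
by move: (over_coef 0 oP); rewrite coefD coefMX coefC add0r.
Qed.

Lemma map_re_inj (P : {poly (dual K)}) : P \is a polyOver S ->
  map_poly (@re K) P = 0 -> P = 0.
Proof.
move=> oP P0; apply/polyP => i; rewrite coef0; apply: membp_re.
  exact: (polyOverP oP).
by rewrite -(coef_map (@re K)) /= P0 coef0.
Qed.

Lemma re_lead_coef (P : {poly (dual K)}) : P \is a polyOver S -> P != 0 ->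
  re (lead_coef P) != 0.
Proof.
move=> oP P0; apply: contra P0 => /eqP /membp_re h.
by rewrite -lead_coef_eq0 h // (polyOverP oP).
Qed.

Definition re_root (y : K) (P : {poly (dual K)}) : Prop :=
  P \is a polyOver S /\ re P.[dual_of y 0] = 0.

Lemma map_re_horner (P : {poly (dual K)}) y z :
  re P.[dual_of y z] = (map_poly (@re K) P).[y].
Proof. by rewrite -horner_map. Qed.

Lemma re_root_lin y m P k : re_root y m -> re_root y P ->
  re_root y (lead_coef m *: P - lead_coef P *: ('X^k * m)).
Proof.
move=> [om rm] [oP rP]; split.
  by rewrite rpredB ?polyOverZ ?rpredM ?rpredX ?polyOverX ?(polyOverP om)
    ?(polyOverP oP).
rewrite hornerD hornerN !hornerZ hornerM rmorphB !rmorphM /= rP rm.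
by rewrite !mulr0 subrr.
Qed.

Lemma re_root_XnsubC y p : G (dual_of (y ^+ p) 0) ->
  re_root y ('X^p - (dual_of (y ^+ p) 0)%:P).
Proof.
move=> Gy; split; last by rewrite !hornerE dual_real_expr subrr.
by rewrite rpredB ?rpredX ?polyOverX ?polyOverC //; apply/asboolP.
Qed.

Definition re_minimal y m : Prop :=
  [/\ re_root y m, m != 0
    & forall P, re_root y P -> (size P < size m)%N -> P = 0].

Lemma re_minimal_exists y P : re_root y P -> P != 0 -> exists m, re_minimal y m.
Proof.
move=> rP P0.
pose A k := `[< exists m, [/\ re_root y m, m != 0 & size m = k] >].
have exA : exists k, A k by exists (size P); apply/asboolP; exists P.
case: (ex_minnP exA) => s /asboolP[m [rm m0 sm]] mins.
exists m; split=> // Q rQ lt; apply/eqP; apply: contraTT lt => Q0.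
by rewrite -leqNgt sm; apply: mins; apply/asboolP; exists Q.
Qed.

(** The relations satisfied by y over the subring are all consequences of a
    minimal one, up to powers of its leading coefficient; as that coefficient
    is a non-zero-divisor in K[eps], it suffices to lift the minimal relation to
    y + z eps. *)
Lemma re_minimal_horner y z m : re_minimal y m -> m.[dual_of y z] = 0 ->
  forall P, re_root y P -> P.[dual_of y z] = 0.
Proof.
move=> [rm m0 mmin] mz; apply: (pseudo_division_ind m0).
- by move=> P k; apply: re_root_lin.
- by move=> P rP lt; rewrite (mmin P rP lt) horner0.
move=> P k rP.
rewrite hornerD hornerN !hornerZ hornerM mz !mulr0 subr0.
by apply: dual_reg; apply: re_lead_coef => //; case: rm.
Qed.

Lemma re_minimal_dvd y m : re_minimal y m ->
  forall P, re_root y P -> map_poly (@re K) m %| map_poly (@re K) P.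
Proof.
move=> [rm m0 mmin]; apply: (pseudo_division_ind m0).
- by move=> P k; apply: re_root_lin.
- by move=> P rP lt; rewrite (mmin P rP lt) rmorph0 dvdp0.
move=> P k rP; rewrite rmorphB /= !map_polyZ rmorphM /=.
rewrite dvdp_subl -?[_ *: (_ * _)]mul_polyC ?dvdp_mull // dvdpZr //.
by apply: re_lead_coef => //; case: rm.
Qed.

Definition adjoin (t : dual K) : set (dual K) :=
  [set u | exists2 P, P \is a polyOver S & u = P.[t]]%classic.

Lemma adjoin_gen t : adjoin t t.
Proof. by exists 'X; rewrite ?polyOverX ?hornerX. Qed.

Lemma adjoin_sub t u : G u -> adjoin t u.
Proof.
by move=> Gu; exists u%:P; rewrite ?hornerC // polyOverC; apply/asboolP.
Qed.

Lemma adjoin_partial_derivation y z :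
  (forall P, re_root y P -> P.[dual_of y z] = 0) ->
  partial_derivation (adjoin (dual_of y z)).
Proof.
move=> h; split.
- by exists 1; rewrite ?rpred1 ?hornerE.
- move=> u v [P oP ->] [Q oQ ->]; exists (P - Q); rewrite ?rpredB //.
  by rewrite !hornerE.
- move=> u v [P oP ->] [Q oQ ->]; exists (P * Q); rewrite ?rpredM //.
  by rewrite !hornerE.
- by move=> u [P oP ->] r; apply: h; split=> //; move: r; rewrite !map_re_horner.
Qed.

Lemma re_minimal_size y m : re_minimal y m -> (1 < size m)%N.
Proof.
move=> [[om rm] m0 _]; rewrite ltnNge; apply: contra m0 => /size1_polyC mE.
have r0 : re m`_0 = 0 by move: rm; rewrite {1}mE hornerC.
by rewrite mE (membp_re (polyOverP om 0%N) r0).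
Qed.

(** If the minimal relation m of y is separable at y, then by Taylor expansion
    z = - m^D(y) / m'(y) is the value at y, with m^D the polynomial of the
    derivatives of the coefficients. If not, then m' = 0 by minimality, so the
    characteristic is a prime p and m is a multiple of X^p - y^p. As y^p has
    derivative 0, this relation holds at y + z eps for every z. *)
Lemma adjoin_step y :
  (forall p, p \in [pchar K] -> G (dual_of (y ^+ p) 0)) ->
  exists z, forall P, re_root y P -> P.[dual_of y z] = 0.
Proof.
move=> hp.
have [[P0 [rP0 P00]]|noP] :=
    pselect (exists P, re_root y P /\ P != 0); last first.
  (* Without relations any value works. *)
  exists 0 => P rP; have [->|P0] := eqVneq P 0; first by rewrite horner0.
  by case: noP; exists P.
have [m mm] := re_minimal_exists rP0 P00.
have [[om rm] m0 mmin] := mm.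
have sm := re_minimal_size mm.
suff [z mz] : exists z, m.[dual_of y z] = 0.
  by exists z; apply: re_minimal_horner mm mz.
have [r'|r'] := eqVneq (re m^`().[dual_of y 0]) 0; last first.
  move: r' rm; rewrite /re; case e' : (m^`().[_]) => [d d'] /= d0.
  case e : (m.[_]) => [a b] /= a0; exists (- b / d).
  rewrite dual_taylor e e' a0.
  change (dual_of 0 b + dual_of 0 (- b / d) * dual_of d d' = 0).
  by rewrite dual_ofM dual_ofD !mul0r !add0r mulrC divfK // subrr.
have m'0 : m^`() = 0.
  by apply: mmin; [split=> //; exact: polyOver_deriv | rewrite lt_size_deriv].
have kR : (size m).-1%:R == 0 :> K.
  have := coef_deriv m (size m).-2; rewrite m'0 coef0.
  have -> : (size m).-2.+1 = (size m).-1 by case: (size m) sm => [|[]].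
  move/(congr1 (@re K)); rewrite rmorph0 raddfMn /= -[_ *+ _]mulr_natr.
  move/esym/eqP; rewrite mulf_eq0 => /orP[|//].
  by rewrite (negPf (re_lead_coef om m0)).
have k0 : (0 < (size m).-1)%N by case: (size m) sm => [|[]].
have [p cp] := natf0_pchar k0 kR.
have p0 := prime_gt0 (pcharf_prime cp).
have pk : (p %| (size m).-1)%N by rewrite (dvdn_pcharf cp).
pose q : {poly (dual K)} := 'X^p - (dual_of (y ^+ p) 0)%:P.
have q0 : q.[dual_of y 0] = 0.
  by rewrite !hornerE dual_real_expr subrr.
have rq : re_root y q := re_root_XnsubC (hp p cp).
have sq : size q = p.+1 by rewrite size_XnsubC.
have smp : size m = p.+1.
  apply/eqP; rewrite eqn_leq; apply/andP; split.
    rewrite leqNgt -sq; apply/negP => /(mmin q rq) /eqP.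
    by rewrite -size_poly_eq0 sq.
  by rewrite -[X in (_ < X)%N](prednK (ltnW sm)) ltnS dvdn_leq.
have mE : m = lead_coef m *: q.
  apply/eqP; rewrite -subr_eq0; apply/eqP; apply: mmin.
    split; last by rewrite hornerD hornerN hornerZ q0 mulr0 subr0.
    by case: rq => oq _; rewrite rpredB ?polyOverZ ?(polyOverP om).
  rewrite smp ltnS; apply/leq_sizeP => j; rewrite leq_eqVlt => /predU1P[<-|lt].
    rewrite coefB coefZ coefB coefXn eqxx coefC (gtn_eqF p0) subr0 mulr1.
    by rewrite lead_coefE smp subrr.
  by rewrite coefB coefZ !nth_default ?smp ?sq ?mulr0 ?subr0.
by exists 0; rewrite mE hornerZ q0 mulr0.
Qed.

End Adjoin.

Lemma pchar_uniq (K : fieldType) p q :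
  p \in [pchar K] -> q \in [pchar K] -> p = q.
Proof.
move=> cp cq; have := dvdn_pcharf cq p; rewrite (pcharf0 cp) eqxx.
by rewrite dvdn_prime2 ?(pcharf_prime cp) ?(pcharf_prime cq) // => /eqP.
Qed.

(** A maximal partial derivation above G0 is total, since an element outside its
    domain could be adjoined. *)
Lemma partial_derivation_extends (K : fieldType) (G0 : set (dual K)) :
  partial_derivation G0 ->
  (forall p y, p \in [pchar K] -> G0 (dual_of (y ^+ p) 0)) ->
  exists2 D : K -> K^o, derivation D & forall u, G0 u -> D (re u) = u.2.
Proof.
move=> hG0 hp.
pose good (A : set (dual K)) := partial_derivation A /\ (G0 `<=` A)%classic.
have [A [[A0|[hA G0A]] maxA]] : exists A : set (dual K),
    (* The empty set is admitted for the sake of the empty chain. *)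
    (A = set0 \/ good A) /\
    (forall B, (A `<` B)%classic -> ~ (B = set0 \/ good B)).
- apply: Zorn_bigcup => C hC tot.
  have [[A1 [CA1 A1n]]|none] := pselect (exists A, C A /\ A <> set0); last first.
    left; rewrite -subset0 => u [A CA Au].
    by apply: none; exists A; split=> // A0; rewrite A0 in Au.
  have goodC A u : C A -> A u -> good A.
    by move=> CA Au; case: (hC A CA) => // A0; rewrite A0 in Au.
  have [a1 A1a1] : (A1 !=set0)%classic by apply/set0P/eqP.
  have join A B u v : C A -> C B -> A u -> B v ->
      exists E, [/\ C E, good E, E u & E v].
    move=> CA CB Au Bv; case: (tot A B CA CB) => sub.
      by exists B; split=> //; [apply: goodC Bv | apply: sub].
    by exists A; split=> //; [apply: goodC Au | apply: sub].
  have [[A1_1 _ _ _] G0A1] := goodC _ _ CA1 A1a1.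
  right; split; last by move=> u /G0A1; exists A1.
  split.
  + by exists A1.
  + move=> u v [A CA Au] [B CB Bv].
    have [E [CE [[_ EB _ _] _] Eu Ev]] := join _ _ _ _ CA CB Au Bv.
    by exists E => //; apply: EB.
  + move=> u v [A CA Au] [B CB Bv].
    have [E [CE [[_ _ EM _] _] Eu Ev]] := join _ _ _ _ CA CB Au Bv.
    by exists E => //; apply: EM.
  + by move=> u [A CA Au]; have [[_ _ _ Are] _] := goodC _ _ CA Au; apply: Are.
- case: (maxA G0); last by right; split.
  rewrite A0; split=> // /(_ 1); apply; by case: hG0.
have [A1 AB AM Are] := hA.
have total y : exists z, A (dual_of y z).
  have [z hz] := adjoin_step hA (fun p cp => G0A _ (hp p y cp)).
  exists z; apply: contrapT => nA.
  apply: (maxA (adjoin A (dual_of y z))).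
    split; first by move=> u; apply: adjoin_sub.
    by move=> sub; apply: nA; apply: sub; apply: adjoin_gen.
  right; split; first exact: adjoin_partial_derivation.
  by move=> u /G0A; apply: adjoin_sub.
pose D y : K^o := projT1 (cid (total y)).
have DA y : A (dual_of y (D y)) by rewrite /D; case: cid.
have Duniq u : A u -> D (re u) = u.2.
  case: u => y z Au; have e := Are _ (AB _ _ (DA y) Au) (subrr y).
  have : D y - z = 0 := congr1 snd e.
  by move/eqP; rewrite subr_eq0 => /eqP.
exists D; last by move=> u /G0A; apply: Duniq.
have AD u v : A u -> A v -> A (u + v).
  move=> Au Av; rewrite -[v]opprK; apply: (AB) => //.
  by rewrite -sub0r; apply: (AB) => //; rewrite -(subrr u); apply: AB.
split=> a b.
  exact: (Duniq _ (AD _ _ (DA a) (DA b))).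
exact: (Duniq _ (AM _ _ (DA a) (DA b))).
Qed.

(** A transcendental x satisfies no relation over the prime field, so 1 can be
    prescribed as the derivative of x over constants. *)
Lemma derivation_transcendental (K : fieldType) (x : K) :
  (forall p, p \notin [pchar K]) ->
  (forall P : {poly K}, P \is a polyOver (@prime_subfield K) -> root P x ->
     P = 0) ->
  exists2 D : K -> K^o, derivation D & D x != 0.
Proof.
move=> char0 trx.
pose G0 : set (dual K) := fun u => re u \in @prime_subfield K /\ u.2 = 0.
have hG0 : partial_derivation G0.
  split.
  - by split; first exact: rpred1.
  - move=> [a a'] [b b'] [/= Fa ->] [/= Fb ->].
    by split; [exact: (rpredB Fa Fb) | rewrite /= subrr].
  - move=> [a a'] [b b'] [/= Fa ->] [/= Fb ->].
    by split; [rewrite rmorphM; exact: rpredM | rewrite /= !mulr0 addr0].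
  - by move=> [a a'] [/= _ ->]; rewrite /re /= => ->.
have h1 P : re_root G0 x P -> P.[dual_of x 1] = 0.
  move=> [oP rP]; rewrite (map_re_inj hG0 oP) ?horner0 //; apply: trx.
    apply/polyOverP => i; rewrite coef_map /=.
    by have [] := over_coef hG0 i oP.
  by apply/rootP; rewrite -(map_re_horner P x 0).
have [|D hD DG] := partial_derivation_extends (adjoin_partial_derivation hG0 h1).
  by move=> p y cp; have := char0 p; rewrite cp.
exists D => //; rewrite (DG (dual_of x 1)) ?oner_eq0 //.
exact: adjoin_gen.
Qed.

(** Derivatives being 0 on K^p, the derivative of x can be prescribed to be 1
    provided that the minimal relation m of x over K^p has m'(x) = 0. It
    divides X^p - x^p = (X - x)^p, hence is a multiple of a power of X - x; if
    x were a simple root it would be a multiple of X - x, and x a p-th power. *)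
Lemma derivation_imperfect (K : fieldType) (p : nat) (x : K) :
  p \in [pchar K] -> (forall y : K, y ^+ p <> x) ->
  exists2 D : K -> K^o, derivation D & D x != 0.
Proof.
move=> cp nx; have p0 := prime_gt0 (pcharf_prime cp).
pose G0 : set (dual K) := fun u => exists a, u = dual_of (a ^+ p) 0.
have hG0 : partial_derivation G0.
  split.
  - by exists 1; rewrite expr1n.
  - move=> u v [a ->] [b ->]; exists (a - b).
    rewrite -!(pFrobenius_autE cp) rmorphB.
    by rewrite /dual_of; congr (_, _); rewrite /= subrr.
  - move=> u v [a ->] [b ->]; exists (a * b).
    by rewrite dual_ofM exprMn !mulr0 addr0.
  - by move=> u [a ->]; rewrite /re /= => ->.
have rq : re_root G0 x ('X^p - (dual_of (x ^+ p) 0)%:P).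
  by apply: (re_root_XnsubC hG0); exists x.
have q0 : 'X^p - (dual_of (x ^+ p) 0)%:P != 0.
  by rewrite -size_poly_eq0 size_XnsubC.
have [m mm] := re_minimal_exists rq q0.
have [[om rm] m0 mmin] := mm; have sm := re_minimal_size hG0 mm.
have real_horner P y : P \is a polyOver (membp G0) -> (P.[dual_of y 0]).2 = 0.
  move: P; apply: (over_horner_ind hG0) => [|P c IHP [a ->]].
    by rewrite horner0.
  rewrite hornerMXaddC; move: IHP; case: (P.[_]) => b b' /= ->.
  by rewrite !mulr0 !addr0.
have m'0 : re m^`().[dual_of x 0] = 0.
  apply/eqP; apply: contrapT => /negP r'.
  have := re_minimal_dvd hG0 mm rq.
  rewrite rmorphB /= map_polyXn map_polyC /=.
  have -> : 'X^p - (re (dual_of (x ^+ p) 0))%:P = ('X - x%:P) ^+ p.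
    have cpX : p \in [pchar {poly K}] by rewrite pchar_poly.
    by rewrite -[RHS](pFrobenius_autE cpX) rmorphB /= !pFrobenius_autE polyC_exp.
  case/dvdp_exp_XsubCP => k kp /eqpP[[c d] /= /andP[c0 d0] E].
  have rmx : (map_poly (@re K) m).[x] = 0 by rewrite -(map_re_horner m x 0).
  have m'x : (map_poly (@re K) m)^`().[x] != 0.
    by rewrite deriv_map -(map_re_horner _ x 0).
  case: k kp E => [|[|k]] kp E.
  - have := congr1 (fun P => P.[x]) E.
    by rewrite /= !hornerE rmx mulr0 => /esym/eqP; rewrite (negPf d0).
  - have E0 := congr1 (fun P : {poly K} => P`_0) E.
    have E1 := congr1 (fun P : {poly K} => P`_1) E.
    move: E0 E1; rewrite /= !coefZ !coef_map /= coefB coefX coefC /= sub0r.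
    rewrite coefB coefX coefC /= subr0 mulr1.
    have [a ->] := over_coef hG0 0 om.
    have [b ->] := over_coef hG0 1 om.
    rewrite /re /= => E0 E1; move: E0; rewrite -E1 mulrN -mulrA -mulrN.
    move/(mulfI c0) => ab.
    have b0 : b != 0.
      apply: contra d0 => /eqP b0; rewrite -E1 b0 expr0n.
      by rewrite (gtn_eqF p0) mulr0.
    apply: (nx (- a / b)); rewrite expr_div_n.
    have -> : (- a) ^+ p = b ^+ p * x.
      rewrite -[LHS](pFrobenius_autE cp) rmorphN /= pFrobenius_autE ab.
      by rewrite opprK.
    by rewrite mulrAC mulfV ?mul1r // expf_neq0.
  have := congr1 (fun P => P^`().[x]) E.
  rewrite !derivZ !hornerZ !exprS !derivM.
  rewrite !(hornerM, hornerD, hornerN, hornerX, hornerC).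
  rewrite subrr !(mul0r, mulr0, addr0) => /eqP.
  by rewrite mulf_eq0 (negPf c0) (negPf m'x).
have h1 P : re_root G0 x P -> P.[dual_of x 1] = 0.
  apply: (re_minimal_horner hG0 mm); rewrite dual_taylor.
  move: m'0 rm (real_horner m x om); rewrite /re.
  case: (m^`().[_]) => [d d'] /= ->; case: (m.[_]) => [a a'] /= -> ->.
  change (dual_of 0 0 + dual_of 0 1 * dual_of 0 d' = 0).
  by rewrite dual_ofM dual_ofD !mul0r !add0r.
have [|D hD DG] := partial_derivation_extends (adjoin_partial_derivation hG0 h1).
  move=> q y cq; apply: (adjoin_sub hG0).
  rewrite (pchar_uniq cq cp).
  by exists y.
exists D => //; rewrite (DG (dual_of x 1)) ?oner_eq0 //.
exact: adjoin_gen.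
Qed.

Theorem derivation_exists (K : fieldType) :
  ~ (algebraic_over_prime_subfield K \/ (perfect_field K /\ positive_char K)) ->
  exists2 D : K -> K^o, derivation D & exists x, D x != 0.
Proof.
move=> /not_orP[nalg nperf].
have [[p cp]|char0] := pselect (positive_char K).
  have [x nx] : exists x : K, forall y : K, y ^+ p <> x.
    apply: contrapT => h; apply: nperf; split; last by exists p.
    move=> q cq x; rewrite (pchar_uniq cq cp).
    apply: contrapT => hx; apply: h; exists x => y yx.
    by apply: hx; exists y.
  by have [D hD Dx] := derivation_imperfect cp nx; exists D => //; exists x.
have [x trx] : exists x : K, forall P : {poly K},
    P \is a polyOver (@prime_subfield K) -> root P x -> P = 0.
  apply: contrapT => h; apply: nalg => x; apply: contrapT => hx; apply: h.
  exists x => P oP rP; apply/eqP; apply: contrapT => /negP P0.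
  by apply: hx; exists P.
have [|D hD Dx] := derivation_transcendental _ trx.
  by move=> p; apply/negP => cp; apply: char0; exists p.
by exists D => //; exists x.
Qed.

(** * Embeddings given by orthogonal bilinear maps *)

Lemma independent_neq0 (K : fieldType) (V : lmodType K) (x y : V) :
  (forall a b, a *: x + b *: y = 0 -> a = 0 /\ b = 0) -> x != 0 /\ y != 0.
Proof.
move=> indep; split; apply/eqP => z0.
  have [] := indep 1 0; first by rewrite z0 scaler0 scale0r addr0.
  by move/eqP; rewrite oner_eq0.
have [] := indep 0 1; first by rewrite z0 scaler0 scale0r addr0.
by move=> _ /eqP; rewrite oner_eq0.
Qed.

Section Pencils.
Variables (n : nat) (K : fieldType).
Implicit Types (v x : 'rV[K]_n.+1) (al : 'cV[K]_n.+1).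
Implicit Types S L H : {vspace 'rV[K]_n.+1}.

Lemma line_basis L : \dim L = 2 -> exists v1 v2,
  [/\ v1 \in L, v2 \in L,
      forall a b, a *: v1 + b *: v2 = 0 -> a = 0 /\ b = 0
    & forall x, x \in L -> exists a b, x = a *: v1 + b *: v2].
Proof.
move=> dL; pose v1 := vpick L; pose v2 := vpick (L :\: <[v1]>)%VS.
have v10 : v1 != 0 by rewrite vpick0 -dimv_eq0 dL.
have v1L : v1 \in L := memv_pick L.
have s1L : (<[v1]> <= L)%VS by rewrite -memvE.
have dD : \dim (L :\: <[v1]>) = 1%N.
  have := dimv_cap_compl L <[v1]>.
  by rewrite (capv_idPr s1L) dim_vline v10 dL => -[].
have v20 : v2 != 0 by rewrite vpick0 -dimv_eq0 dD.
have v2D : v2 \in (L :\: <[v1]>)%VS := memv_pick _.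
have v2L : v2 \in L := subvP (diffvSl _ _) _ v2D.
have DE : (L :\: <[v1]>)%VS = <[v2]>%VS.
  by apply/esym/eqP; rewrite eqEdim -memvE v2D dD dim_vline v20.
exists v1, v2; split=> // [a b e|x].
  have b0 : b = 0.
    apply/eqP; apply: contraNT v20 => b0.
    have : v2 \in ((L :\: <[v1]>) :&: <[v1]>)%VS.
      rewrite memv_cap v2D /=; apply/vlineP; exists (- (b^-1 * a)).
      have /(congr1 ( *:%R b^-1)) := e.
      rewrite scalerDr !scalerA mulVf // scale1r scaler0 => /eqP.
      by rewrite addrC addr_eq0 scaleNr => /eqP.
    by rewrite capv_diff memv0.
  move: e; rewrite b0 scale0r addr0 => /eqP.
  by rewrite scaler_eq0 (negPf v10) orbF => /eqP.
rewrite -{1}(addv_diff_cap L <[v1]>) (capv_idPr s1L) DE.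
case/memv_addP => y /vlineP[b ->] [z /vlineP[a ->] ->].
by exists a, b; rewrite addrC.
Qed.

Lemma hyp_of_full al : (forall x, x *m al = 0) -> al = 0.
Proof. by move=> h; apply/row_matrixP => i; rewrite row0 rowE h. Qed.

(** With x1, x2 a basis of a complement of S, the functionals with kernels
    S + <x1> and S + <x2> are a dual basis up to scalars. *)
Lemma pencil_basis S : (\dim S + 2 = n.+1)%N -> exists al1 al2,
  [/\ (S <= hyp_of al1)%VS, (S <= hyp_of al2)%VS,
      forall a b, a *: al1 + b *: al2 = 0 -> a = 0 /\ b = 0
    & forall al, (S <= hyp_of al)%VS -> exists a b, al = a *: al1 + b *: al2].
Proof.
move=> dS.
have dC : \dim S^C = 2%N.
  by rewrite dimv_compl dimvf /dim /= mul1n -[X in (X - _)%N]dS addKn.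
have [x1 [x2 [x1C x2C indep gen]]] := line_basis dC.
have x12 : x1 \notin <[x2]>%VS /\ x2 \notin <[x1]>%VS.
  split; apply/negP => /vlineP[c xE].
    have := indep 1 (- c); rewrite scale1r scaleNr -xE subrr.
    by case/(_ erefl) => /eqP; rewrite oner_eq0.
  have := indep (- c) 1; rewrite scale1r scaleNr -xE addNr.
  by case/(_ erefl) => _ /eqP; rewrite oner_eq0.
have [x10 x20] : x1 != 0 /\ x2 != 0.
  by split; [move: x12.1 | move: x12.2]; apply: contra => /eqP ->; rewrite mem0v.
have SC x : x \in S -> x \in S^C%VS -> x = 0.
  move=> xS xC; apply/eqP; rewrite -memv0 -(capv_compl S) memv_cap xS.
  exact: xC.
have hyp x : x != 0 -> x \in S^C%VS -> exists2 al, (S <= hyp_of al)%VS &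
    x *m al = 0 /\ forall y, y \in S^C%VS -> y *m al = 0 -> y \in <[x]>%VS.
  move=> x0 xC; have dH : \dim (S + <[x]>) = n.
    rewrite dimv_disjoint_sum ?dim_vline ?x0.
      by apply: succn_inj; rewrite -addnS dS.
    apply/eqP; rewrite -subv0; apply/subvP => y; rewrite memv_cap memv0.
    case/andP=> yS /vlineP[c yE]; apply/eqP; apply: SC => //.
    by rewrite yE memvZ.
  have [al al0 alE] := hyperplane_functional dH.
  exists al.
    by apply/subvP => y yS; rewrite mem_hyp_of -alE (subvP (addvSl _ _)).
  split; first by apply/eqP; rewrite -alE (subvP (addvSr _ _)) // memv_line.
  move=> y yC /eqP; rewrite -alE => /memv_addP[s sS [z /vlineP[c ->] yE]].
  have s0 : s = 0.
    by apply: SC => //; rewrite (_ : s = y - c *: x) ?rpredB ?memvZ // yE addrK.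
  by rewrite yE s0 add0r memvZ ?memv_line.
have [al1 S1 [a11 a12]] := hyp x1 x10 x1C.
have [al2 S2 [a22 a21]] := hyp x2 x20 x2C.
pose ev (x : 'rV[K]_n.+1) (al : 'cV[K]_n.+1) := (x *m al) 0 0.
have ev0 x al : ev x al = 0 -> x *m al = 0 := @mx11_eq0 _ _.
have e12 : ev x2 al1 != 0.
  by apply/eqP => /ev0 /(a12 _ x2C); apply/negP; case: x12.
have e21 : ev x1 al2 != 0.
  by apply/eqP => /ev0 /(a21 _ x1C); apply/negP; case: x12.
have evD x a b : ev x (a *: al1 + b *: al2) = a * ev x al1 + b * ev x al2.
  by rewrite /ev mulmxDr -!scalemxAr !mxE.
have e11 : ev x1 al1 = 0 by rewrite /ev a11 mxE.
have e22 : ev x2 al2 = 0 by rewrite /ev a22 mxE.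
exists al1, al2; split=> // [a b e|al Sal].
  have := evD x1 a b; have := evD x2 a b; rewrite e e11 e22 !mulr0 addr0 add0r.
  rewrite /ev !mulmx0 mxE => /esym/eqP.
  rewrite mulf_eq0 (negPf e12) orbF => /eqP ->.
  by move/esym/eqP; rewrite mulf_eq0 (negPf e21) orbF => /eqP ->.
pose a := ev x2 al / ev x2 al1; pose b := ev x1 al / ev x1 al2.
exists a, b; apply/eqP; rewrite -subr_eq0; apply/eqP/hyp_of_full => x.
have : x \in (S + S^C)%VS by rewrite addv_complf memvf.
case/memv_addP=> s sS [y /gen[c [d ->]] ->].
have z0 al' : (S <= hyp_of al')%VS -> s *m al' = 0.
  by move/subvP/(_ s sS); rewrite mem_hyp_of => /eqP.
rewrite mulmxDl !mulmxBr mulmxDr -!scalemxAr !z0 // !scaler0 addr0 subrr add0r.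
rewrite -mulmxBr mulmxDl -!scalemxAl.
have K0 x' : ev x' al = ev x' (a *: al1 + b *: al2) ->
    x' *m (al - (a *: al1 + b *: al2)) = 0.
  by move=> e; apply: mx11_eq0; rewrite mulmxBr mxE [X in _ + X]mxE;
    apply/eqP; rewrite subr_eq0; apply/eqP.
rewrite !K0 ?scaler0 ?addr0 // evD ?e11 ?e22 mulr0 ?addr0 ?add0r.
  by rewrite /a divfK.
by rewrite /b divfK.
Qed.

End Pencils.

(** A map bilinear on orthogonal pairs and compatible with the rank-one
    matrices through a linear rho is an embedding on its span: rho separates
    flags, and each line of the geometry comes from a plane of rows or of columns, on
    which the map is linear. The natural embedding and its covers by derivations are both of
    this form. *)
Section OrthEmbedding.
Variables (n : nat) (K : fieldType) (V : lmodType K).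
Variable w : 'rV[K]_n.+1 -> 'cV[K]_n.+1 -> V.
Hypothesis hw : orth_bilinear w.
Variable rho : {linear V -> 'M[K]_n.+1}.
Hypothesis rho_w : forall v al, v *m al = 0 -> rho (w v al) = al *m v.

Lemma orth_rep_neq0 F v al : is_flag_rep F v al -> w v al != 0.
Proof.
move=> r; have [v0 _ al0 _] := r; apply: contra (rank1_neq0 v0 al0) => /eqP w0.
by rewrite -rho_w ?(rep_mul0 r) // w0 linear0.
Qed.

Definition orth_eps (F : geom_point (A1n n K)) : pg_point V :=
  pg_of (orth_rep_neq0 (projT2 (cid (flag_rep_exists F)))).

Lemma orth_epsE F v al :
  is_flag_rep F v al -> pg_set (orth_eps F) = vline (w v al).
Proof.
move=> r; rewrite /orth_eps /=; case: cid => -[v' al'] /= r'.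
have [c [d [c0 d0 -> ->]]] := rep_uniq r r'; have h := rep_mul0 r.
rewrite (obZr hw) -?scalemxAl ?h ?scaler0 // (obZl hw) // scalerA.
have dc0 : d * c != 0 by rewrite mulf_neq0.
apply/seteqP; split=> x [k _ <-] /=.
  by exists (k * (d * c)); rewrite ?scalerA.
by exists (k / (d * c)); rewrite // scalerA divfK.
Qed.

Variable e : geom_point (A1n n K) -> pg_point V.
Hypothesis eE : forall F v al,
  is_flag_rep F v al -> pg_set (e F) = vline (w v al).

Lemma orth_embedding_inj : injective e.
Proof.
move=> F1 F2 eF.
have [[v1 a1] /= r1] := flag_rep_exists F1.
have [[v2 a2] /= r2] := flag_rep_exists F2.
have : vline (w v1 a1) (w v2 a2).
  by rewrite -(eE r1) eF (eE r2); exists 1; rewrite ?scale1r.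
case=> c _ cw; have [v10 _ a10 _] := r1; have [v20 _ a20 _] := r2.
have c0 : c != 0.
  by apply: contraTN (orth_rep_neq0 r2) => /eqP c0; rewrite -cw c0 scale0r eqxx.
have E : a1 *m (c *: v1) = a2 *m v2.
  rewrite -scalemxAr -(rho_w (rep_mul0 r1)) -(rho_w (rep_mul0 r2)) -cw.
  by rewrite linearZ.
have cv0 : c *: v1 != 0 by rewrite scaler_eq0 negb_or c0.
have [d d0 [v2E a2E]] := rank1_factors cv0 a10 v20 a20 E.
apply: (@rep_flag_eq _ _ F1 F2 v1 a1 (d * c) d^-1) => //.
- by rewrite mulf_neq0.
- by rewrite invr_eq0.
- by rewrite -scalerA -v2E -a2E.
Qed.

Lemma is_pg_line_image (l : set (flag n K)) (w1 w2 : V) F1 F2 :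
  F1 <> F2 -> pg_set (e F1) = vline w1 -> pg_set (e F2) = vline w2 ->
  (forall F, l F -> exists a b, pg_set (e F) = vline (a *: w1 + b *: w2)) ->
  (forall a b, a *: w1 + b *: w2 != 0 ->
     exists2 F, l F & pg_set (e F) = vline (a *: w1 + b *: w2)) ->
  is_pg_line (e @` l)%classic.
Proof.
move=> nF E1 E2 sub sup; exists (e F1), (e F2).
split; first by move/orth_embedding_inj.
rewrite E1 E2; apply/seteqP; split=> [R [F lF <-]|R] /=.
  have [a [b ->]] := sub F lF => x [c _ <-].
  exists ((c * a) *: w1); first by exists (c * a).
  exists ((c * b) *: w2); first by exists (c * b).
  by rewrite scalerDr !scalerA.
have [u u0 RE] := pg_pointP R; rewrite RE => uR.
have : vline u u by exists 1; rewrite ?scale1r.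
move/uR => [_ [a _ <-] [_ [b _ <-] uE]].
have [|F lF FE] := sup a b; first by rewrite uE.
by exists F => //; apply: pg_point_inj; rewrite FE RE uE.
Qed.

Lemma orth_embedding_line l :
  geom_line (A1n n K) l -> is_pg_line (e @` l)%classic.
Proof.
case=> [[p [S [dp dS pS ->]]]|[L [H [dL dH LH ->]]]].
  have [a1 [a2 [S1 S2 indep gen]]] := pencil_basis dS.
  pose v := vpick p.
  have v0 : v != 0 by rewrite vpick0 -dimv_eq0 dp.
  have pE : p = <[v]>%VS.
    by apply/esym/eqP; rewrite eqEdim -memvE memv_pick dp dim_vline v0.
  have vS : v \in S by rewrite (subvP pS) // memv_pick.
  have vS0 al : (S <= hyp_of al)%VS -> v *m al = 0.
    by move/subvP/(_ v vS); rewrite mem_hyp_of => /eqP.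
  have mk al : al != 0 -> (S <= hyp_of al)%VS ->
      exists2 F, flag_line_pS p S F & is_flag_rep F v al.
    move=> al0 Sal; have [F r] := rep_exists v0 al0 (vS0 _ Sal).
    by exists F => //; split; rewrite ?(rep_pt r) ?(rep_hyp r).
  have [a10 a20] := independent_neq0 indep.
  have [F1 l1 r1] := mk _ a10 S1; have [F2 l2 r2] := mk _ a20 S2.
  have wE a b : w v (a *: a1 + b *: a2) = a *: w v a1 + b *: w v a2.
    by rewrite (obDr hw) ?(obZr hw) // -?scalemxAr vS0 ?scaler0.
  apply: (is_pg_line_image _ (eE r1) (eE r2)).
  - move=> F12; rewrite F12 in r1.
    have [c [d [_ d0 _ a2E]]] := rep_uniq r1 r2.
    have := indep d (-1); rewrite a2E scaleN1r subrr => /(_ erefl) [dd _].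
    by rewrite dd eqxx in d0.
  - move=> F [Fp FS].
    have [al al0 alE] := hyperplane_functional (flag_hyp_dim F).
    have r : is_flag_rep F v al by split; rewrite ?Fp ?memv_pick.
    have [|a [b alab]] := gen al; first by rewrite -(rep_hyp r).
    by exists a, b; rewrite (eE r) alab wE.
  - move=> a b; rewrite -wE => w0.
    have al0 : a *: a1 + b *: a2 != 0.
      by apply: contra w0 => /eqP ->; rewrite (ob0r hw).
    have [|F lF r] := mk _ al0; last by exists F => //; rewrite (eE r).
    apply/subvP => x xS; rewrite mem_hyp_of mulmxDr -!scalemxAr.
    move/subvP/(_ x xS): S1; move/subvP/(_ x xS): S2.
    by rewrite !mem_hyp_of => /eqP -> /eqP ->; rewrite !scaler0 addr0.
have [v1 [v2 [v1L v2L indep gen]]] := line_basis dL.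
have [al al0 alE] := hyperplane_functional dH.
have L0 v : v \in L -> v *m al = 0.
  by move=> vL; apply/eqP; rewrite -alE (subvP LH).
have HE : H = hyp_of al by apply/vspaceP => x; rewrite alE mem_hyp_of.
have mk v : v != 0 -> v \in L ->
    exists2 F, flag_line_LH L H F & is_flag_rep F v al.
  move=> v0 vL; have [F r] := rep_exists v0 al0 (L0 _ vL).
  by exists F => //; split; rewrite ?(rep_pt r) ?(rep_hyp r) // -memvE.
have [v10 v20] := independent_neq0 indep.
have [F1 l1 r1] := mk _ v10 v1L; have [F2 l2 r2] := mk _ v20 v2L.
have wE a b : w (a *: v1 + b *: v2) al = a *: w v1 al + b *: w v2 al.
  by rewrite (obDl hw) ?(obZl hw) // -?scalemxAl L0 ?scaler0.
apply: (is_pg_line_image _ (eE r1) (eE r2)).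
- move=> F12; rewrite F12 in r1.
  have [c [d [c0 _ v2E _]]] := rep_uniq r1 r2.
  have := indep c (-1); rewrite v2E scaleN1r subrr => /(_ erefl) [cc _].
  by rewrite cc eqxx in c0.
- move=> F [FH FL].
  have r : is_flag_rep F (vpick (flag_pt F)) al.
    split; rewrite ?memv_pick ?FH // vpick0 -dimv_eq0.
    by rewrite (flag_pt_dim F).
  have [|a [b vE]] := gen (vpick (flag_pt F)).
    by rewrite (subvP FL) ?memv_pick.
  by exists a, b; rewrite (eE r) vE wE.
- move=> a b; rewrite -wE => w0.
  have v0 : a *: v1 + b *: v2 != 0.
    by apply: contra w0 => /eqP ->; rewrite (ob0l hw).
  have [|F lF r] := mk _ v0; last by exists F => //; rewrite (eE r).
  by rewrite rpredD ?memvZ.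
Qed.

Lemma orth_embedding :
  (forall W, is_subspace W -> (forall v al, v *m al = 0 -> W (w v al)) ->
     W = setT) ->
  is_embedding e.
Proof.
move=> span; split; [exact: orth_embedding_inj | exact: orth_embedding_line |].
move=> W sW We; apply: span => // v al val0; have [W0 _ _] := sW.
have [->|v0] := eqVneq v 0; first by rewrite (ob0l hw).
have [->|al0] := eqVneq al 0; first by rewrite (ob0r hw).
have [F r] := rep_exists v0 al0 val0.
by apply: (We F); rewrite (eE r); exists 1; rewrite ?scale1r.
Qed.

End OrthEmbedding.


Section NaturalEmbedding.
Variables (n : nat) (K : fieldType).

Definition nat_bilinear (v : 'rV[K]_n.+1) (al : 'cV[K]_n.+1) :
  trace0_mx n.+1 K := insubd 0 (al *m v).

Lemma val_nat_bilinear v al : v *m al = 0 -> val (nat_bilinear v al) = al *m v.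
Proof.
by move=> h; rewrite val_insubd unfold_in mxtrace_mulC h mxtrace0 eqxx.
Qed.

Lemma nat_bilinear_orth : orth_bilinear nat_bilinear.
Proof.
split=> [a v al h|a v al h|v v' al h h'|v al al' h h']; apply: val_inj;
  rewrite /= ?(linearZ, linearD) /= !val_nat_bilinear //.
- by rewrite scalemxAr.
- by rewrite -scalemxAl h scaler0.
- by rewrite scalemxAl.
- by rewrite -scalemxAr h scaler0.
- by rewrite mulmxDr.
- by rewrite mulmxDl h h' addr0.
- by rewrite mulmxDl.
- by rewrite mulmxDr h h' addr0.
Qed.

Lemma trace_lift_nat (M : trace0_mx n.+1 K) :
  trace_lift nat_bilinear (val M) = M.
Proof.
apply: val_inj.
rewrite (trace_lift_comp (val : {linear trace0_mx n.+1 K -> 'M[K]_n.+1})).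
rewrite (trace_lift_ext val_nat_bilinear) trace_lift_rank1 //.
by apply/eqP; exact: (valP M).
Qed.

Lemma eps_nat_vline F v al : is_flag_rep F v al ->
  pg_set (@eps_nat n K F) = vline (nat_bilinear v al).
Proof.
move=> r; rewrite (eps_natE r) /=; congr (vline _); apply: val_inj.
by rewrite val_nat_bilinear // (rep_mul0 r).
Qed.

Lemma eps_nat_embedding : is_embedding (@eps_nat n K).
Proof.
apply: (orth_embedding nat_bilinear_orth val_nat_bilinear eps_nat_vline).
move=> W sW Ww; apply/seteqP; split=> // M _.
by rewrite -(trace_lift_nat M); apply: trace_lift_mem.
Qed.

End NaturalEmbedding.

(** * A derivation gives a proper cover of the natural embedding *)

Section DerivationCover.
Variables (n : nat) (K : fieldType) (D : K -> K^o).
Hypothesis hD : derivation D.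
Let DD := hD.1.
Let DM := hD.2.

Local Notation cover := (trace0_mx n.+1 K * K^o)%type.

Definition der_form (v : 'rV[K]_n.+1) (al : 'cV[K]_n.+1) : K^o :=
  \sum_i v 0 i * D (al i 0).

Definition der_bilinear v al : cover := (nat_bilinear v al, der_form v al).

Lemma der_bilinear_orth : orth_bilinear der_bilinear.
Proof.
have nb := @nat_bilinear_orth n K.
split=> [a v al h|a v al h|v v' al h h'|v al al' h h']; congr (_, _);
  rewrite ?(obZl nb) ?(obZr nb) ?(obDl nb) ?(obDr nb) //= /der_form.
- change (\sum_i (a *: v) 0 i * D (al i 0) = a * \sum_i v 0 i * D (al i 0)).
  by rewrite mulr_sumr; apply: eq_bigr => i _; rewrite mxE -mulrA.
- change (\sum_i v 0 i * D ((a *: al) i 0) = a * \sum_i v 0 i * D (al i 0)).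
  transitivity (a * \sum_i v 0 i * D (al i 0) + D a * \sum_i v 0 i * al i 0).
    rewrite !mulr_sumr -big_split; apply: eq_bigr => i _ /=.
    by rewrite mxE DM /GRing.scale /=; ring.
  move/matrixP: h => /(_ 0 0); rewrite !mxE => ->.
  by rewrite mulr0 addr0.
- by rewrite -big_split; apply: eq_bigr => i _; rewrite mxE mulrDl.
- by rewrite -big_split; apply: eq_bigr => i _; rewrite mxE DD mulrDr.
Qed.

Lemma der_bilinear_val v al : v *m al = 0 ->
  (val \o fst) (der_bilinear v al) = al *m v.
Proof. exact: val_nat_bilinear. Qed.

Definition cover_eps := orth_eps der_bilinear_val.

(** The subspace contains (M, 0) for every trace-zero M, because the pairs that
    define the linear extension have last coordinate 0. It also contains a point
    with last coordinate D x, from the pair (e_j - x e_0, e_0 + x e_j), and the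
    difference is (0, D x). *)
Lemma cover_span (n_gt0 : (0 < n)%N) (W : set cover) x : D x != 0 ->
  is_subspace W -> (forall v al, v *m al = 0 -> W (der_bilinear v al)) ->
  W = setT.
Proof.
move=> Dx sW Ww; have [W0 WD WZ] := sW.
have D0 : D 0 = 0 := der0 hD.
have D1 : D 1 = 0 := der1 hD.
have Dec (i k : 'I_n.+1) : D ((ec i : 'cV[K]_n.+1) k 0) = 0.
  by rewrite mxE; case: (_ && _); rewrite /= ?D0 ?D1.
have form_ec v i : der_form v (ec i) = 0.
  by rewrite /der_form big1 // => k _; rewrite Dec mulr0.
have W1 (M : trace0_mx n.+1 K) : W (M, 0).
  have -> : (M, 0) = trace_lift der_bilinear (val M) :> cover.
    rewrite [RHS]surjective_pairing; congr (_, _).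
      by rewrite (trace_lift_comp (fst : {linear cover -> trace0_mx n.+1 K}))
        trace_lift_nat.
    rewrite (trace_lift_comp (snd : {linear cover -> K^o})) /trace_lift /=.
    rewrite big1 ?add0r => [|i _]; last first.
      by rewrite big1 // => j _; rewrite form_ec scaler0.
    rewrite big1 // => j j0; rewrite /torus_lift !form_ec subr0 addr0.
    rewrite /der_form big1 ?scaler0 // => k _.
    by rewrite [X in D X]mxE DD !Dec addr0 mulr0.
  exact: trace_lift_mem.
have W2 : W (0, D x).
  have [j jn0] : exists j : 'I_n.+1, j != 0.
    by exists (Ordinal (n_gt0 : (1 < n.+1)%N)).
  have j0 := negPf jn0; have j0' : (0 == j) = false by rewrite eq_sym.
  pose v : 'rV[K]_n.+1 := er j - x *: er 0; pose al := ec 0 + x *: ec j.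
  have val0 : v *m al = 0 by rewrite /v /al; orth (j0, j0').
  have -> : (0, D x) = der_bilinear v al + (-1) *: (nat_bilinear v al, 0).
    rewrite scaleN1r; congr (_, _); rewrite /= ?subrr // subr0.
    rewrite /der_form (bigD1 j) //= big1 => [|k kj]; last first.
      rewrite !mxE eqxx andbT (negPf kj) mulr0 addr0.
      by case: (_ == _); rewrite /= ?D0 ?D1 mulr0.
    by rewrite !mxE !eqxx j0 /= !mulr0 mulr1 subr0 add0r mul1r addr0.
  exact: (WD _ _ (Ww _ _ val0) (WZ (-1) _ (W1 _))).
apply/seteqP; split=> // -[M c] _.
pose k : K := c / D x.
have -> : (M, c) = (M, 0) + k *: (0, D x) :> cover.
  congr (_, _); rewrite /= ?scaler0 ?addr0 ?add0r //.
  by rewrite /k /GRing.scale /= divfK.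
exact: (WD _ _ (W1 M) (WZ _ _ W2)).
Qed.

Lemma derivation_cover (n_gt0 : (0 < n)%N) x : D x != 0 ->
  is_embedding cover_eps /\ proper_cover cover_eps (@eps_nat n K).
Proof.
move=> Dx; have cE := orth_epsE der_bilinear_orth der_bilinear_val.
split.
  apply: (orth_embedding der_bilinear_orth der_bilinear_val cE).
  by move=> W; apply: cover_span Dx.
exists idfun, (fst : {linear cover -> trace0_mx n.+1 K}); split; first split.
- by exists id.
- move=> F; have [[v al] r] := flag_rep_exists F.
  rewrite (eps_nat_vline r) (cE F v al r).
  apply/seteqP; split=> y /=.
    by case=> a _ <-; exists (a *: der_bilinear v al); first exists a.
  by case=> u [a _ <-] <-; exists a.
- move=> /(_ (0, 1) (0, 0) erefl) [] /eqP; rewrite oner_eq0.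
  by [].
Qed.

End DerivationCover.

(** * Without derivations every cover is injective *)


Section Twist.
Variables (K K' : fieldType) (V : lmodType K').

(** An embedding that covers the natural one may live over another field K',
    isomorphic to K; restricting scalars along the isomorphism turns a
    semilinear map into a linear one. *)
Definition twisted of {rmorphism K -> K'} : Type := V.

Variable tau : {rmorphism K -> K'}.
HB.instance Definition _ := GRing.Zmodule.copy (twisted tau) V.

Definition twist_scale (a : K) (u : twisted tau) : twisted tau :=
  tau a *: (u : V).
Lemma twist_scaleA a b u :
  twist_scale a (twist_scale b u) = twist_scale (a * b) u.
Proof. by rewrite /twist_scale scalerA rmorphM. Qed.
Lemma twist_scale1 : left_id 1 twist_scale.
Proof. by move=> u; rewrite /twist_scale rmorph1 scale1r. Qed.
Lemma twist_scaleDr : right_distributive twist_scale +%R.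
Proof. by move=> a u v; rewrite /twist_scale scalerDr. Qed.
Lemma twist_scaleDl u : {morph twist_scale^~ u : a b / a + b}.
Proof. by move=> a b; rewrite /twist_scale rmorphD scalerDl. Qed.
HB.instance Definition _ := GRing.Zmodule_isLmodule.Build K (twisted tau)
  twist_scaleA twist_scale1 twist_scaleDr twist_scaleDl.
End Twist.

Lemma vline_eq (K : fieldType) (V : lmodType K) (u x : V) :
  vline x u -> u != 0 -> vline u = vline x.
Proof.
case=> a _ <-; rewrite scaler_eq0 negb_or => /andP[a0 _].
apply/seteqP; split=> y [c _ <-] /=; first by exists (c * a); rewrite ?scalerA.
by exists (c / a); rewrite // scalerA divfK.
Qed.

Section Rigidity.
Variables (n : nat) (K K' : fieldType) (V : lmodType K').
Variable e' : geom_point (A1n n K) -> pg_point V.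
Variables (sigma : {rmorphism K' -> K}) (tau : {rmorphism K -> K'}).
Hypotheses (sigmaK : cancel sigma tau) (tauK : cancel tau sigma).
Variable phi : {linear V -> trace0_mx n.+1 K | sigma \; *:%R}.
Hypothesis e'_embedding : is_embedding e'.
Hypothesis e'_cover :
  forall F, pg_set (eps_nat F) = (phi @` pg_set (e' F))%classic.

Lemma phiZ a u : phi (a *: u) = sigma a *: phi u.
Proof. by rewrite linearZ. Qed.

Lemma e'_vline F u : pg_set (e' F) u -> u != 0 -> pg_set (e' F) = vline u.
Proof.
have [x x0 ->] := pg_pointP (e' F).
by move=> xu u0; rewrite (vline_eq xu u0).
Qed.

Lemma phi_neq0 F u : pg_set (e' F) u -> u != 0 -> phi u != 0.
Proof.
move=> Fu u0; have [[v al] r] := flag_rep_exists F.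
have : pg_set (eps_nat F) (nat_mx r).
  by rewrite (eps_natE r); exists 1; rewrite ?scale1r.
rewrite e'_cover (e'_vline Fu u0) => -[_ [a _ <-]]; rewrite phiZ => E.
by apply: contra (nat_mx_neq0 r) => /eqP u'; rewrite -E u' scaler0.
Qed.

Lemma phi_inj F u u' :
  pg_set (e' F) u -> pg_set (e' F) u' -> phi u = phi u' -> u = u'.
Proof.
have [x x0 E] := pg_pointP (e' F).
have Fx : pg_set (e' F) x by rewrite E; exists 1; rewrite ?scale1r.
rewrite E => -[a _ <-] [b _ <-]; rewrite !phiZ => /eqP.
rewrite -subr_eq0 -scalerBl scaler_eq0 (negPf (phi_neq0 Fx x0)) orbF subr_eq0.
by move=> /eqP /(can_inj sigmaK) ->.
Qed.

Lemma eps_nat_phi F u : pg_set (e' F) u -> u != 0 ->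
  pg_set (eps_nat F) = vline (phi u).
Proof.
move=> Fu u0; rewrite e'_cover (e'_vline Fu u0); apply/seteqP; split=> y /=.
  by case=> _ [a _ <-] <-; rewrite phiZ; exists (sigma a).
by case=> a _ <-; exists (tau a *: u); [exists (tau a) | rewrite phiZ tauK].
Qed.

(** On a line the lift is additive: the image line is spanned by the lifts of
    two of its points, and phi, independent on these, forces the coefficients
    of a third lift. *)
Lemma line_additive l F1 F2 F3 u1 u2 u3 :
  geom_line (A1n n K) l -> l F1 -> l F2 -> l F3 -> F1 <> F2 ->
  pg_set (e' F1) u1 -> pg_set (e' F2) u2 -> pg_set (e' F3) u3 ->
  u1 != 0 -> u2 != 0 -> phi u3 = phi u1 + phi u2 -> u3 = u1 + u2.
Proof.
move=> ll l1 l2 l3 F12 e1 e2 e3 u10 u20 E3.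
have [e'inj e'line _] := e'_embedding.
have indep c : phi u1 <> c *: phi u2.
  move=> E; apply: F12; have [inj _ _] := eps_nat_embedding n K.
  apply: inj; apply: pg_point_inj.
  rewrite (eps_nat_phi e1 u10) (eps_nat_phi e2 u20).
  by apply: vline_eq; [exists c | exact: phi_neq0 e1 u10].
have indep' c : u1 <> c *: u2.
  by move=> E; apply: (indep (sigma c)); rewrite E phiZ.
have [P [Q [_ lE]]] := e'line l ll.
have [p _ PE] := pg_pointP P; have [q _ QE] := pg_pointP Q.
have onl F u : l F -> pg_set (e' F) u -> exists a b, u = a *: p + b *: q.
  move=> lF Fu; have : (e' @` l)%classic (e' F) by exists F.
  rewrite lE => /(_ u Fu) /=; rewrite PE QE.
  by case=> _ [a _ <-] [_ [b _ <-] <-]; exists a, b.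
have [a1 [b1 E1]] := onl _ _ l1 e1; have [a2 [b2 E2]] := onl _ _ l2 e2.
have [a3 [b3 E3']] := onl _ _ l3 e3.
(* By Cramer's rule p and q, and hence u3, are combinations of u1 and u2. *)
pose d := a1 * b2 - a2 * b1.
have dp : d *: p = b2 *: u1 - b1 *: u2.
  rewrite E1 E2 !scalerDr !scalerA opprD addrACA -!scalerBl.
  by rewrite (mulrC b2 b1) subrr scale0r addr0 /d (mulrC a1) (mulrC a2).
have dq : d *: q = a1 *: u2 - a2 *: u1.
  rewrite E1 E2 !scalerDr !scalerA opprD addrACA -!scalerBl.
  by rewrite (mulrC a1 a2) subrr scale0r add0r.
have d0 : d != 0.
  apply/eqP => d0; move: dp dq; rewrite d0 !scale0r.
  have [b20|b20] := eqVneq b2 0; last first.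
    move/esym/eqP; rewrite subr_eq0 => /eqP /(congr1 ( *:%R b2^-1)).
    by rewrite !scalerA mulVf // scale1r => /indep'.
  have [a20|a20 _] := eqVneq a2 0.
    by case/eqP: u20; rewrite E2 b20 a20 !scale0r addr0.
  move/esym/eqP; rewrite subr_eq0 eq_sym => /eqP /(congr1 ( *:%R a2^-1)).
  by rewrite !scalerA mulVf // scale1r => /indep'.
have [x [y E]] : exists x y, u3 = x *: u1 + y *: u2.
  exists (d^-1 * (a3 * b2 - b3 * a2)), (d^-1 * (b3 * a1 - a3 * b1)).
  apply: (scalerI d0); rewrite scalerDr !scalerA !mulrA mulfV // !mul1r.
  rewrite E3' scalerDr !scalerA (mulrC d a3) (mulrC d b3) -!scalerA dp dq.
  rewrite !scalerBr !scalerBl !scalerA [X in _ + X = _]addrC [LHS]addrACA.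
  by congr (_ + _); exact: addrC.
have := E3; rewrite E linearD !phiZ => /eqP.
have [sx|sx] := eqVneq (sigma x) 1; last first.
  rewrite -subr_eq0 opprD addrACA -{2}[phi u1]scale1r -{2}[phi u2]scale1r.
  rewrite -!scalerBl addrC addr_eq0 => /eqP H.
  have sx0 : sigma x - 1 != 0 by rewrite subr_eq0.
  case: (indep (- (sigma x - 1)^-1 * (sigma y - 1))).
  by rewrite -scalerA H scalerN scaleNr opprK scalerA mulVf // scale1r.
rewrite sx scale1r (inj_eq (addrI _)) -subr_eq0 -{2}[phi u2]scale1r -scalerBl.
rewrite scaler_eq0 (negPf (phi_neq0 e2 u20)) orbF subr_eq0 => /eqP sy.
have s1 : sigma 1 = 1 := rmorph1 _.
rewrite -(sigmaK x) -(sigmaK y) sx sy -s1 sigmaK.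
by rewrite !scale1r.
Qed.

(** phi is injective on each point of the image of e', so a representative al v
    of the natural image of a flag has a unique preimage in the point of e' at
    that flag. *)
Definition lift (v : 'rV[K]_n.+1) (al : 'cV[K]_n.+1) : V :=
  xget 0 [set u | exists F,
    [/\ is_flag_rep F v al, pg_set (e' F) u & val (phi u) = al *m v]]%classic.

Lemma liftP F v al : is_flag_rep F v al ->
  pg_set (e' F) (lift v al) /\ val (phi (lift v al)) = al *m v.
Proof.
move=> r; rewrite /lift; set P := (X in xget _ X).
have exP : exists u, P u.
  have : pg_set (eps_nat F) (nat_mx r).
    by rewrite (eps_natE r); exists 1; rewrite ?scale1r.
  by rewrite e'_cover => -[u Fu uE]; exists u, F; split=> //; rewrite uE.
have [F' [r' Fu uE]] := xgetPex 0 exP; split=> //.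
suff -> : F = F' by [].
by apply: (@rep_flag_eq _ _ F F' v al 1 1); rewrite ?oner_eq0 ?scale1r.
Qed.

Lemma liftE F v al u : is_flag_rep F v al -> pg_set (e' F) u ->
  val (phi u) = al *m v -> u = lift v al.
Proof.
move=> r Fu uE; have [Fl lE] := liftP r.
by apply: (phi_inj Fu Fl); apply: val_inj; rewrite uE lE.
Qed.

Lemma lift_neq0 F v al : is_flag_rep F v al -> lift v al != 0.
Proof.
move=> r; have [v0 _ al0 _] := r; have [_ lE] := liftP r.
by apply: contra (rank1_neq0 v0 al0) => /eqP l0; rewrite -lE l0 linear0.
Qed.

Lemma lift0l al : lift 0 al = 0.
Proof. by apply: xgetPN => u [F [[]]]; rewrite eqxx. Qed.

Lemma lift0r v : lift v 0 = 0.
Proof. by apply: xgetPN => u [F [[_ _]]]; rewrite eqxx. Qed.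

Lemma liftZ c d v al : v *m al = 0 ->
  lift (c *: v) (d *: al) = tau (c * d) *: lift v al.
Proof.
move=> val0.
have [->|v0] := eqVneq v 0; first by rewrite scaler0 !lift0l scaler0.
have [->|al0] := eqVneq al 0; first by rewrite scaler0 !lift0r scaler0.
have [->|c0] := eqVneq c 0.
  by rewrite scale0r lift0l mul0r rmorph0 scale0r.
have [->|d0] := eqVneq d 0.
  by rewrite scale0r lift0r mulr0 rmorph0 scale0r.
have [F r] := rep_exists v0 al0 val0.
have [Fl lE] := liftP r; symmetry; apply: (liftE (rep_scale r c0 d0)).
  rewrite (e'_vline Fl (lift_neq0 r)).
  by exists (tau (c * d)).
by rewrite phiZ tauK /= lE -scalemxAl -scalemxAr scalerA mulrC.
Qed.

(** For independent columns the three flags lie on the line of the hyperplanes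
    through the intersection of two of them; proportional columns are a matter
    of scaling. *)
Lemma liftDr v al al' : v *m al = 0 -> v *m al' = 0 ->
  lift v (al + al') = lift v al + lift v al'.
Proof.
move=> val0 val0'.
have [->|v0] := eqVneq v 0; first by rewrite !lift0l addr0.
have [->|al0] := eqVneq al 0; first by rewrite lift0r !add0r.
have [[c ->]|nc] := pselect (exists c, al' = c *: al).
  rewrite -{1 3}[v]scale1r -{1}[al]scale1r -scalerDl !liftZ // !mul1r.
  by rewrite rmorphD rmorph1 scalerDl scale1r.
have al0' : al' != 0 by apply/eqP => al0'; apply: nc; exists 0; rewrite scale0r.
have alD0 : al + al' != 0.
  apply/eqP => /eqP; rewrite addrC addr_eq0 => /eqP alN; apply: nc.
  by exists (-1); rewrite scaleN1r.
have valD : v *m (al + al') = 0 by rewrite mulmxDr val0 val0' addr0.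
have [F1 r1] := rep_exists v0 al0 val0; have [F2 r2] := rep_exists v0 al0' val0'.
have [F3 r3] := rep_exists v0 alD0 valD.
have F12 : F1 <> F2.
  move=> F12; rewrite F12 in r1; have [c [d [_ _ _ al'E]]] := rep_uniq r1 r2.
  by apply: nc; exists d.
have [l1 E1] := liftP r1; have [l2 E2] := liftP r2; have [l3 E3] := liftP r3.
pose S := (flag_hyp F1 :&: flag_hyp F2)%VS.
have H12 : flag_hyp F1 != flag_hyp F2.
  apply/eqP => H12; apply: F12.
  by apply: flag_eq; rewrite ?(rep_pt r1) ?(rep_pt r2).
have dS : (\dim S + 2 = n.+1)%N.
  have := dimv_sum_cap (flag_hyp F1) (flag_hyp F2).
  have dle : (\dim (flag_hyp F1 + flag_hyp F2) <= n.+1)%N.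
    by rewrite (leq_trans (dimvS (subvf _))) // dimvf /dim /= mul1n.
  have dge : (n < \dim (flag_hyp F1 + flag_hyp F2))%N.
    rewrite ltnNge; apply: contra H12 => le.
    have eqH F : flag_hyp F = (flag_hyp F1 + flag_hyp F2)%VS \/
        ~~ (flag_hyp F <= flag_hyp F1 + flag_hyp F2)%VS.
      case sub : (_ <= _)%VS; [left|by right].
      by apply/eqP; rewrite eqEdim sub flag_hyp_dim.
    case: (eqH F1) => [h1|]; last by rewrite addvSl.
    case: (eqH F2) => [h2|]; last by rewrite addvSr.
    by apply/eqP; exact: etrans h1 (esym h2).
  have -> : \dim (flag_hyp F1 + flag_hyp F2) = n.+1.
    by apply/eqP; rewrite eqn_leq dle.
  rewrite !flag_hyp_dim addSn -addnS => /addnI dS.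
  by rewrite addn2 dS.
apply: (@line_additive (flag_line_pS <[v]> S) F1 F2 F3) => //.
- left; exists <[v]>%VS, S; split=> //; first by rewrite dim_vline v0.
  by rewrite subv_cap -{1}(rep_pt r1) -(rep_pt r2) !flag_incident.
- by split; [exact: rep_pt r1 | exact: capvSl].
- by split; [exact: rep_pt r2 | exact: capvSr].
- split; first exact: rep_pt r3.
  apply/subvP => x; rewrite memv_cap (rep_hyp r1) (rep_hyp r2) (rep_hyp r3).
  by rewrite !mem_hyp_of mulmxDr => /andP[/eqP -> /eqP ->]; rewrite addr0.
- exact: lift_neq0 r1.
- exact: lift_neq0 r2.
- by apply: val_inj; rewrite linearD /= E1 E2 E3 mulmxDl.
Qed.

Lemma liftDl v v' al : v *m al = 0 -> v' *m al = 0 ->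
  lift (v + v') al = lift v al + lift v' al.
Proof.
move=> val0 val0'.
have [->|al0] := eqVneq al 0; first by rewrite !lift0r addr0.
have [->|v0] := eqVneq v 0; first by rewrite lift0l !add0r.
have [[c ->]|nc] := pselect (exists c, v' = c *: v).
  rewrite -{1 3}[al]scale1r -{1}[v]scale1r -scalerDl !liftZ // !mulr1.
  by rewrite rmorphD rmorph1 scalerDl scale1r.
have v0' : v' != 0 by apply/eqP => v0'; apply: nc; exists 0; rewrite scale0r.
have vD0 : v + v' != 0.
  apply/eqP => /eqP; rewrite addrC addr_eq0 => /eqP vN; apply: nc.
  by exists (-1); rewrite scaleN1r.
have valD : (v + v') *m al = 0 by rewrite mulmxDl val0 val0' addr0.
have [F1 r1] := rep_exists v0 al0 val0; have [F2 r2] := rep_exists v0' al0 val0'.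
have [F3 r3] := rep_exists vD0 al0 valD.
have F12 : F1 <> F2.
  move=> F12; rewrite F12 in r1; have [c [d [_ _ v'E _]]] := rep_uniq r1 r2.
  by apply: nc; exists c.
have [l1 E1] := liftP r1; have [l2 E2] := liftP r2; have [l3 E3] := liftP r3.
pose L := (<[v]> + <[v']>)%VS.
have dL : \dim L = 2%N.
  rewrite dimv_disjoint_sum ?dim_vline ?v0 ?v0' //.
  apply/eqP; rewrite -subv0; apply/subvP => y; rewrite memv_cap memv0.
  case/andP=> /vlineP[c ->] /vlineP[d yE].
  have [d0|d0] := eqVneq d 0; first by rewrite yE d0 scale0r.
  case: nc; exists (d^-1 * c); move/(congr1 ( *:%R d^-1)): yE.
  by rewrite !scalerA mulVf // scale1r.
apply: (@line_additive (flag_line_LH L (hyp_of al)) F1 F2 F3) => //.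
- right; exists L, (hyp_of al); split=> //; first exact: dim_hyp_of.
  by rewrite subv_add -!memvE !mem_hyp_of val0 val0' eqxx.
- by split; [exact: rep_hyp r1 | rewrite (rep_pt r1) addvSl].
- by split; [exact: rep_hyp r2 | rewrite (rep_pt r2) addvSr].
- split; first exact: rep_hyp r3.
  by rewrite (rep_pt r3) -memvE memv_add ?memv_line.
- exact: lift_neq0 r1.
- exact: lift_neq0 r2.
- by apply: val_inj; rewrite linearD /= E1 E2 E3 mulmxDr.
Qed.

Lemma lift_orth :
  orth_bilinear (lift : 'rV[K]_n.+1 -> 'cV[K]_n.+1 -> twisted V tau).
Proof.
split.
- by move=> a v al h; rewrite -{1}[al]scale1r [LHS]liftZ // mulr1.
- by move=> a v al h; rewrite -{1}[v]scale1r [LHS]liftZ // mul1r.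
- exact: liftDl.
- exact: liftDr.
Qed.

(** The linear map through which the lift factors is a left inverse of phi on
    the points of e', hence on their span. *)
Lemma cover_injective : (2 <= n)%N ->
  (forall (U : lmodType K) (D : K -> U), derivation D -> forall a, D a = 0) ->
  injective phi.
Proof.
move=> n2 noD.
pose s (M : 'M[K]_n.+1) : twisted V tau :=
  trace_lift (lift : _ -> _ -> twisted V tau) M.
have sE v al : v *m al = 0 -> lift v al = s (al *m v).
  exact: (orth_bilinear_factor n2 (noD (twisted V tau)) lift_orth).
pose W : set V := [set u | s (val (phi u)) = u]%classic.
have sW : is_subspace W.
  split=> [|u u' Wu Wu'|a u Wu]; rewrite /W /mkset.
  - by rewrite !linear0 [LHS](linear0 (trace_lift _)).
  - by rewrite !linearD [LHS](linearD (trace_lift _)); exact: congr2 Wu Wu'.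
  - rewrite phiZ linearZ.
    have -> : s (sigma a *: val (phi u)) =
        tau (sigma a) *: (s (val (phi u)) : V).
      exact: (linearZ_LR (trace_lift (lift : _ -> _ -> twisted V tau))).
    by rewrite sigmaK; exact: (congr1 ( *:%R a) Wu).
have WT : W = setT.
  have [_ _ span] := e'_embedding; apply: span => // F u Fu.
  have [[v al] r] := flag_rep_exists F; have [Fl lE] := liftP r.
  move: Fu; rewrite (e'_vline Fl (lift_neq0 r)) => -[a _ <-].
  have [_ _ WZ] := sW; apply: WZ; rewrite /W /= lE -sE //.
  exact: rep_mul0 r.
move=> u u' E; have Wu x : W x by rewrite WT.
by rewrite -(Wu u) -(Wu u') /= E.
Qed.

End Rigidity.

Theorem corollary1p3 (n : nat) (K : fieldType) (n_ge2 : (2 <= n)%N) :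
  relatively_universal (@eps_nat n K) <->
  (algebraic_over_prime_subfield K \/ (perfect_field K /\ positive_char K)).
Proof.
split=> [[_ noCover]|algperf].
  apply: contrapT => /derivation_exists[D hD [x Dx]]; apply: noCover.
  exists K, _, (@cover_eps n K D).
  exact: (derivation_cover hD (ltnW n_ge2) Dx).
have noD (U : lmodType K) (D : K -> U) : derivation D -> forall a, D a = 0.
  move=> hD; case: algperf => [alg|[perf pos]].
    exact: derivation_algebraic.
  exact: derivation_perfect.
split; first exact: eps_nat_embedding.
case=> K' [V [e' [he' [sigma [phi [[[tau sigmaK tauK] cov]]]]]]]; apply.
have tauB : zmod_morphism tau := can2_zmod_morphism sigmaK tauK.
have tauM : monoid_morphism tau := can2_monoid_morphism sigmaK tauK.
pose tau' : {rmorphism K -> K'} := HB.pack tau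
  (GRing.isZmodMorphism.Build K K' tau tauB)
  (GRing.isMonoidMorphism.Build K K' tau tauM).
exact: (@cover_injective n K K' V e' sigma tau' sigmaK tauK phi he' cov
  n_ge2 noD).
Qed.
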